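(* Let $X\subseteq\overline{\mathbb F}_q^{\,k}$ be an irreducible variety that is MDS (equivalently, not contained in any hyperplane through the origin), and let $S$ be a set of points of $X\cap\mathbb F_q^k$. Let $G$ be a $k\times n$ matrix whose columns are chosen uniformly at random from $S$, and let $r,L$ be positive integers. Then the code generated by $G$ is $\operatorname{rLD-MDS}_r(\le L)$ (equivalently, its dual is $\operatorname{rMDS}_r(L+1)$) with probability at least $1-2^{(L+1)n}\binom{n}{r/2}2^{r(L+1)/2}\left(\frac{P_q(X,L)}{|S|}\right)^{r/2}$ when the columns are chosen independently (repeated columns allowed), and at least $1-2^{(L+1)n}\binom{n}{r/2}2^{r(L+1)/2}\left(\frac{P_q(X,L)}{|S|-n}\right)^{r/2}$ when repeated columns are not allowed.
   Context: A variety $X\subseteq\overline{\mathbb F}^k$ is MDS if for every $n$, a $k\times n$ matrix whose columns are generic points of $X$ generates an MDS code; an irreducible variety is MDS iff it is not contained in any hyperplane through the origin. $P_q(X,\ell)$ is the maximum, over polynomials of degree $\ell$ that do not vanish identically on $X$, of the number of zeros in $X\cap\mathbb F_q^k$. A code $C\subseteq\mathbb F^n$ of dimension $k$ is $(\rho,L)$ average-radius list-decodable if for every $y\in\mathbb F^n$ and every $L+1$ distinct codewords $c_0,\dots,c_L$, $\frac{1}{L+1}\sum_i\operatorname{wt}(y-c_i)>\rho n$. It is $\operatorname{rLD-MDS}_d(L)$ if this holds with $\rho=\frac{L}{L+1}\frac{n-k-d}{n}$, and $\operatorname{rLD-MDS}_d(\le L)$ if it is $\operatorname{rLD-MDS}_d(\ell)$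 for all $1\le\ell\le L$. For a code with $k'\times n$ generator matrix $V$ and $A_1,\dots,A_\ell\subseteq[n]$, $\mathcal G_{A_1,\dots,A_\ell}[V]$ is the block matrix whose $i$-th block row has $I_{k'}$ in the first block column and $V|_{A_i}$ (columns of $V$ in $A_i$) in block column $i+1$; the code is $\operatorname{rMDS}_d(\ell)$ if $\mathcal G_{A_1,\dots,A_\ell}[V]$ has full column rank whenever $\mathcal G_{A_1,\dots,A_\ell}[W]$ does, $W$ a generic $(k'-d)\times n$ matrix.
   Formalization: The formal theorem takes r even, since the binomial coefficient of n over r/2 is undefined for odd r, and it states only the rLD-MDS_r(≤L) conclusion, not the equivalent one that the dual is rMDS_r(L+1). *)

(* Defs.v *)
From HB Require Import structures.
From mathcomp Require Import all_boot all_order all_algebra all_field.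
From mathcomp Require Import mpoly.
From Stdlib Require Import ClassicalEpsilon.
Set Implicit Arguments. Unset Strict Implicit. Unset Printing Implicit Defensive.
Import Order.TTheory GRing.Theory Num.Theory.
Local Open Scope ring_scope.

Definition asb (P : Prop) : bool :=
  if excluded_middle_informative P then true else false.

Section Variety.
Variables (K : fieldType) (k : nat).

Definition ev (p : {mpoly K[k]}) (x : 'cV[K]_k) : K := p.@[fun i => x i ord0].

Definition zariski_closed (Z : 'cV[K]_k -> Prop) : Prop :=
  exists I : {mpoly K[k]} -> Prop, forall x, Z x <-> (forall p, I p -> ev p x = 0).

Definition irreducible_variety (X : 'cV[K]_k -> Prop) : Prop :=
  [/\ zariski_closed X, exists x, X x &
      forall Z1 Z2, zariski_closed Z1 -> zariski_closed Z2 ->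
        (forall x, X x -> Z1 x \/ Z2 x) ->
        (forall x, X x -> Z1 x) \/ (forall x, X x -> Z2 x)].

Definition MDS_variety (X : 'cV[K]_k -> Prop) : Prop :=
  forall a : 'rV[K]_k, a != 0 -> exists x, X x /\ (a *m x) ord0 ord0 != 0.
End Variety.

Section Pq.
Variables (F : finFieldType) (K : fieldType) (iota : {rmorphism F -> K}) (k : nat).

Definition rat_zeros (X : 'cV[K]_k -> Prop) (f : {mpoly K[k]}) : {set 'cV[F]_k} :=
  [set x : 'cV[F]_k | asb (X (map_mx iota x) /\ ev f (map_mx iota x) = 0)].

Definition Pq (X : 'cV[K]_k -> Prop) (l : nat) : nat :=
  \max_(A : {set 'cV[F]_k} |
          asb (exists f : {mpoly K[k]}, [/\ (msize f <= l.+1)%N,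
                 (exists x, X x /\ ev f x != 0) & A = rat_zeros X f])) #|A|.
End Pq.

Section Codes.
Variables (F : fieldType) (k n : nat).

Definition wt (v : 'rV[F]_n) : nat := #|[set i : 'I_n | v ord0 i != 0]|.

Definition avg_radius_LD (C : 'rV[F]_n -> Prop) (rho : rat) (L : nat) : Prop :=
  forall (y : 'rV[F]_n) (c : 'I_L.+1 -> 'rV[F]_n), injective c ->
    (forall i, C (c i)) ->
    ((\sum_(i < L.+1) wt (y - c i))%:R / (L.+1)%:R > rho * n%:R :> rat).

Definition rLD_MDS (d L : nat) (G : 'M[F]_(k, n)) : Prop :=
  avg_radius_LD (fun c => (c <= G)%MS)
    ((L%:R / (L.+1)%:R) * ((n%:R - (\rank G)%:R - d%:R) / n%:R)) L.

Definition rLD_MDS_le (d L : nat) (G : 'M[F]_(k, n)) : Prop :=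
  forall l, (1 <= l <= L)%N -> rLD_MDS d l G.
End Codes.

Section Random.
Variables (F : finFieldType) (k n : nat).

Definition mx_of_cols (f : {ffun 'I_n -> 'cV[F]_k}) : 'M[F]_(k, n) :=
  \matrix_(i, j) f j i ord0.

Definition prob_rep (S : {set 'cV[F]_k}) (P : 'M[F]_(k, n) -> Prop) : rat :=
  (#|[set f : {ffun 'I_n -> 'cV[F]_k} |
        [forall j, f j \in S] && asb (P (mx_of_cols f))]|)%:R
  / (#|[set f : {ffun 'I_n -> 'cV[F]_k} | [forall j, f j \in S]]|)%:R.

Definition prob_norep (S : {set 'cV[F]_k}) (P : 'M[F]_(k, n) -> Prop) : rat :=
  (#|[set f : {ffun 'I_n -> 'cV[F]_k} |
        [&& [forall j, f j \in S], injectiveb f & asb (P (mx_of_cols f))]]|)%:R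
  / (#|[set f : {ffun 'I_n -> 'cV[F]_k} |
        [forall j, f j \in S] && injectiveb f]|)%:R.
End Random.

Definition fail_bound (n r L P m : nat) : rat :=
  (2 ^ (L.+1 * n) * 'C(n, r./2) * 2 ^ (r * L.+1)./2)%:R * (P%:R / m%:R) ^+ r./2.

(* Main.v *)
(* Failure of list decoding produces messages m_v, v in J, not all equal, such that
   m_v and m_w agree at the j-th column of G whenever v, w lie in a common edge E_j,
   where the hypergraph (E_j) on J is (k + r)-partition connected: every partition of
   J into p parts is crossed, counting with multiplicity, at least (k + r)(p - 1) times.

   Points in general position on X allow no such messages once the hypergraph is
   k-partition connected.  If some proper subset of J is already connected enough,
   one treats this subset and its contraction separately.  Otherwise one specialises
   the points on the edges through a root vertex, one after another, to the centre
   of a place of the function field of X.  In suitable coordinates each coordinate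
   of the generic point dominates the following ones at this place, so an edge
   specialised to the centre kills, at each of its vertices, the first coordinate not
   yet killed.  Submodularity keeps the hypergraph partition connected along the way.

   Reveal the columns one by one, and call a column faulty if, with all later points in
   general position, the messages were forced to be equal before but no longer are;
   it is then a zero of a polynomial of degree at most L determined by the previous
   columns.  A faulty column is replaced by a general point of the
   same type kept in reserve.  A failing matrix has r/2 faulty columns, found in at
   most 2^(L+1) passes, and these are encoded by a set of columns and a label in
   2^(L+1) for each of them. *)

Require Import Defs.
From HB Require Import structures.
From mathcomp Require Import all_boot all_order all_algebra all_field.
From mathcomp Require Import perm mpoly zify lra.
From Stdlib Require Import Classical ClassicalEpsilon.
Set Implicit Arguments. Unset Strict Implicit. Unset Printing Implicit Defensive.
Import Order.TTheory GRing.Theory Num.Theory.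
Local Open Scope ring_scope.

(** * Places of the function field of a variety *)

Section Place.
Variables (K : closedFieldType) (k : nat) (X : 'cV[K]_k -> Prop).
Implicit Types (f g u w : 'cV[K]_k -> K) (G : ('cV[K]_k -> K) -> K -> Prop).

Definition generically (A : 'cV[K]_k -> Prop) :=
  exists h : {mpoly K[k]},
    (exists x, X x /\ ev h x != 0) /\ forall x, X x -> ev h x != 0 -> A x.

(** Irreducibility in the form used below: two nonempty principal open subsets of [X] meet, that is,
    the vanishing ideal of [X] is prime. *)
Definition prime_locus :=
  (exists x, X x) /\ forall f g : {mpoly K[k]},
    (exists x, X x /\ ev f x != 0) -> (exists x, X x /\ ev g x != 0) ->
    exists x, [/\ X x, ev f x != 0 & ev g x != 0].

Hypothesis Xprime : prime_locus.

Lemma generically_all (A : 'cV[K]_k -> Prop) :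
  (forall x, X x -> A x) -> generically A.
Proof.
move=> AX; exists 1; split; last by move=> x Xx _; exact: AX.
by have [[x Xx] _] := Xprime; exists x; rewrite /ev rmorph1 oner_eq0.
Qed.

Lemma generically_and (A1 A2 A : 'cV[K]_k -> Prop) :
  generically A1 -> generically A2 ->
  (forall x, A1 x -> A2 x -> A x) -> generically A.
Proof.
move=> [h1 [nz1 A1h]] [h2 [nz2 A2h]] A12; exists (h1 * h2); split.
  have [x [Xx n1 n2]] := Xprime.2 _ _ nz1 nz2.
  by exists x; rewrite /ev mevalM mulf_neq0.
move=> x Xx; rewrite /ev mevalM mulf_eq0 negb_or => /andP[n1 n2].
by apply: A12; [exact: A1h | exact: A2h].
Qed.

Lemma generically_sub (A B : 'cV[K]_k -> Prop) :
  generically A -> (forall x, A x -> B x) -> generically B.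
Proof. by move=> [h [nz Ah]] AB; exists h; split=> // x Xx /(Ah x Xx)/AB. Qed.

Lemma generically_ex (A : 'cV[K]_k -> Prop) :
  generically A -> exists x, X x /\ A x.
Proof. by move=> [h [[x [Xx nz]] Ah]]; exists x; split => //; exact: Ah. Qed.

(* [G f c] means that the place takes the finite value [c] at the rational
   function [f]; functions count up to equality at the generic point of [X]. *)
Record place G : Prop := Place {
  place_const : forall c, G (fun=> c) c;
  place_add : forall f g a b, G f a -> G g b -> G (fun x => f x + g x) (a + b);
  place_mul : forall f g a b, G f a -> G g b -> G (fun x => f x * g x) (a * b);
  place_eq : forall f g a, G f a -> generically (fun x => f x = g x) -> G g a;
  place_inj : forall f a, G f a -> generically (fun x => f x = 0) -> a = 0 }.

Lemma place_eqX G f g a : place G -> G f a -> (forall x, X x -> f x = g x) -> G g a.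
Proof. by move=> PG Gf fg; apply: (place_eq PG Gf); exact: generically_all. Qed.

Lemma place_opp G f a : place G -> G f a -> G (fun x => - f x) (- a).
Proof.
move=> PG Gf; rewrite -mulN1r.
by apply: (place_eqX PG (place_mul PG (place_const PG (-1)) Gf)) => x _; rewrite mulN1r.
Qed.

Lemma place_sum G (I : Type) (r : seq I) (P : pred I) (f : I -> 'cV[K]_k -> K)
    (a : I -> K) : place G -> (forall i, P i -> G (f i) (a i)) ->
  G (fun x => \sum_(i <- r | P i) f i x) (\sum_(i <- r | P i) a i).
Proof.
move=> PG Gf; elim: r => [|i r IHr].
  rewrite big_nil; apply: (place_eqX PG (place_const PG 0)) => x _.
  by rewrite big_nil.
rewrite big_cons; case: ifP => Pi.
  by apply: (place_eqX PG (place_add PG (Gf i Pi) IHr)) => x _; rewrite big_cons Pi.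
by apply: (place_eqX PG IHr) => x _; rewrite big_cons Pi.
Qed.

Lemma place_prod G (I : Type) (r : seq I) (P : pred I) (f : I -> 'cV[K]_k -> K)
    (a : I -> K) : place G -> (forall i, P i -> G (f i) (a i)) ->
  G (fun x => \prod_(i <- r | P i) f i x) (\prod_(i <- r | P i) a i).
Proof.
move=> PG Gf; elim: r => [|i r IHr].
  rewrite big_nil; apply: (place_eqX PG (place_const PG 1)) => x _.
  by rewrite big_nil.
rewrite big_cons; case: ifP => Pi.
  by apply: (place_eqX PG (place_mul PG (Gf i Pi) IHr)) => x _; rewrite big_cons Pi.
by apply: (place_eqX PG IHr) => x _; rewrite big_cons Pi.
Qed.

Lemma place_det G d (M : 'cV[K]_k -> 'M[K]_d) (N : 'M[K]_d) : place G ->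
  (forall i j, G (fun x => M x i j) (N i j)) -> G (fun x => \det (M x)) (\det N).
Proof.
move=> PG GM; apply: (place_sum _ PG) => s _; apply: (place_mul PG).
  exact: (place_const PG).
by apply: (place_prod _ PG).
Qed.

(** The trivial place on the constants, from which the extensions start. *)
Lemma generic_place : place (fun f c => generically (fun x => f x = c)).
Proof.
split=> [c|f g a b fa gb|f g a b fa gb|f g a fa fg|f a fa f0].
- exact: generically_all.
- by apply: (generically_and fa gb) => x -> ->.
- by apply: (generically_and fa gb) => x -> ->.
- by apply: (generically_and fa fg) => x <- ->.
- have [x [_ [<-]]] : exists x, X x /\ (f x = a /\ f x = 0).
    by apply: generically_ex; apply: (generically_and fa f0) => x.
  by [].
Qed.

(** Division with remainder leads to an element of the ideal that divides all others; it is no unit,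
    so it has a root in the closed field [K]. *)
Lemma poly_ideal_root (I : {poly K} -> Prop) :
  (forall p q, I p -> I q -> I (p + q)) -> (forall p q, I q -> I (p * q)) ->
  ~ I 1 -> exists c, forall q, I q -> q.[c] = 0.
Proof.
move=> Iadd Imul I1.
have [[h [Ih h0]] | none] := classic (exists h, I h /\ h != 0); last first.
  exists 0 => q Iq; have [-> | q0] := eqVneq q 0; first by rewrite horner0.
  by case: none; exists q.
have [d] := ubnP (size h); elim: d => // d IHd in h Ih h0 * => le_hd.
have [[q [Iq ndv]] | dv] := classic (exists q, I q /\ ~~ (h %| q)).
  have Ir : I (q %% h).
    rewrite (_ : q %% h = q + (- (q %/ h)) * h); first by apply: Iadd => //; exact: Imul.
    by rewrite {2}(divp_eq q h) mulNr addrAC subrr add0r.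
  by apply: (IHd (q %% h)) => //; rewrite -ltnS; apply: leq_trans le_hd; rewrite ltnS ltn_modp.
have /closed_rootP[c /rootP hc] : size h != 1.
  apply/negP => /size_poly1P[a a0 hE]; apply: I1.
  by rewrite -(polyC1) -(mulVf a0) polyCM -hE; exact: Imul.
exists c => q Iq; have /dvdpP[h' ->] : h %| q.
  by apply/negP => /negP ndv; case: dv; exists q.
by rewrite hornerM hc mulr0.
Qed.

(* The ring [G[u]], together with the value [c] given to [u]. *)
Definition adjoin G u c f b := exists (p : 'cV[K]_k -> {poly K}) (q : {poly K}) d,
  [/\ forall x, (size (p x) <= d)%N, (size q <= d)%N,
      forall i, G (fun x => (p x)`_i) q`_i,
      generically (fun x => f x = (p x).[u x]) & b = q.[c]].

(** The images under the place of the polynomial relations satisfied by [u]: a value given to [u]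
    must be a common root of them. *)
Definition value_ideal G u (q : {poly K}) := exists (p : 'cV[K]_k -> {poly K}) d,
  [/\ forall x, (size (p x) <= d)%N, (size q <= d)%N,
      forall i, G (fun x => (p x)`_i) q`_i &
      generically (fun x => (p x).[u x] = 0)].

Lemma adjoin_sub G u c f b : place G -> G f b -> adjoin G u c f b.
Proof.
move=> PG Gf; exists (fun x => (f x)%:P), b%:P, 1; split=> [x||i||].
- exact: size_polyC_leq1.
- exact: size_polyC_leq1.
- rewrite coefC; case: eqP => [->|/eqP/negPf i0].
    by apply: (place_eqX PG Gf) => x _; rewrite coefC.
  by apply: (place_eqX PG (place_const PG 0)) => x _; rewrite coefC i0.
- by apply: generically_all => x _; rewrite hornerC.
- by rewrite hornerC.
Qed.

Lemma adjoin_gen G u c : place G -> adjoin G u c u c.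
Proof.
move=> PG; exists (fun x => 'X), 'X, 2; split=> [x||i||]; rewrite ?size_polyX ?hornerX //.
  exact: (place_const PG).
by apply: generically_all => x _; rewrite hornerX.
Qed.

Lemma adjoin_place G u c : place G ->
  (forall q, value_ideal G u q -> q.[c] = 0) -> place (adjoin G u c).
Proof.
move=> PG Ic; split=> [a|f g a b|f g a b|f g a|f a].
- exact/(adjoin_sub _ _ PG)/(place_const PG).
- move=> [p [q [d [sp sq Gp fp ->]]]] [p' [q' [d' [sp' sq' Gp' gp ->]]]].
  exists (fun x => p x + p' x), (q + q'), (maxn d d'); split=> [x||i||].
  + apply: (leq_trans (size_polyD _ _)); rewrite geq_max !leq_max.
    by rewrite sp sp' orbT.
  + apply: (leq_trans (size_polyD _ _)); rewrite geq_max !leq_max.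
    by rewrite sq sq' orbT.
  + rewrite coefD; apply: (place_eqX PG (place_add PG (Gp i) (Gp' i))) => x _.
    by rewrite coefD.
  + by apply: (generically_and fp gp) => x -> ->; rewrite hornerD.
  + by rewrite hornerD.
- move=> [p [q [d [sp sq Gp fp ->]]]] [p' [q' [d' [sp' sq' Gp' gp ->]]]].
  exists (fun x => p x * p' x), (q * q'), (d + d')%N; split=> [x||i||].
  + apply: (leq_trans (size_polyMleq _ _)); apply: leq_trans (leq_pred _) _.
    exact: leq_add.
  + apply: (leq_trans (size_polyMleq _ _)); apply: leq_trans (leq_pred _) _.
    exact: leq_add.
  + rewrite coefM; apply: (place_eqX PG (f := fun x =>
      \sum_(j < i.+1) (p x)`_j * (p' x)`_(i - j))) => [|x _]; last by rewrite coefM.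
    by apply: (place_sum _ PG) => j _; exact: (place_mul PG).
  + by apply: (generically_and fp gp) => x -> ->; rewrite hornerM.
  + by rewrite hornerM.
- move=> [p [q [d [sp sq Gp fp ->]]]] fg; exists p, q, d; split=> //.
  by apply: (generically_and fp fg) => x <- ->.
- move=> [p [q [d [sp sq Gp fp ->]]]] f0; apply: Ic; exists p, d; split=> //.
  by apply: (generically_and fp f0) => x <- ->.
Qed.

Lemma value_ideal_root G u : place G -> ~ value_ideal G u 1 ->
  exists c, forall q, value_ideal G u q -> q.[c] = 0.
Proof.
move=> PG; apply: poly_ideal_root.
  move=> q q' [p [d [sp sq Gp up]]] [p' [d' [sp' sq' Gp' up']]].
  exists (fun x => p x + p' x), (maxn d d'); split=> [x||i|].
  + apply: (leq_trans (size_polyD _ _)); rewrite geq_max !leq_max.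
    by rewrite sp sp' orbT.
  + apply: (leq_trans (size_polyD _ _)); rewrite geq_max !leq_max.
    by rewrite sq sq' orbT.
  + rewrite coefD; apply: (place_eqX PG (place_add PG (Gp i) (Gp' i))) => x _.
    by rewrite coefD.
  + by apply: (generically_and up up') => x ux ux'; rewrite hornerD ux ux' addr0.
move=> h q [p [d [sp sq Gp up]]].
exists (fun x => h * p x), (size h + d)%N; split=> [x||i|].
+ apply: (leq_trans (size_polyMleq _ _)); apply: leq_trans (leq_pred _) _.
  exact: leq_add.
+ apply: (leq_trans (size_polyMleq _ _)); apply: leq_trans (leq_pred _) _.
  exact: leq_add.
+ rewrite coefM; apply: (place_eqX PG (f := fun x =>
      \sum_(j < i.+1) h`_j * (p x)`_(i - j))) => [|x _]; last by rewrite coefM.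
  apply: (place_sum _ PG) => j _; apply: (place_mul PG) => //.
  exact: (place_const PG).
+ by apply: (generically_sub up) => x ux; rewrite hornerM ux mulr0.
Qed.

(* Of two relations [1 + .. = 0] for [u] and [1 + .. = 0] for [w = 1/u], the one
   of larger degree has its degree lowered by means of the other one. *)
Lemma value_ideal_inverse G : place G -> forall N u w (p q : 'cV[K]_k -> {poly K}) d e,
  (d + e <= N)%N -> generically (fun x => u x * w x = 1) ->
  (forall x, (size (p x) <= d.+1)%N) -> (forall x, (size (q x) <= e.+1)%N) ->
  (forall i, G (fun x => (p x)`_i) (i == 0%N)%:R) ->
  (forall i, G (fun x => (q x)`_i) (i == 0%N)%:R) ->
  generically (fun x => (p x).[u x] = 0) ->
  generically (fun x => (q x).[w x] = 0) -> False.
Proof.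
move=> PG; have base (p : 'cV[K]_k -> {poly K}) u : (forall x, (size (p x) <= 1)%N) ->
    (forall i, G (fun x => (p x)`_i) (i == 0%N)%:R) ->
    generically (fun x => (p x).[u x] = 0) -> False.
  move=> sp Gp up; suff /eqP : (0 == 0)%N%:R = 0 :> K by rewrite oner_eq0.
  apply: (place_inj PG (Gp 0%N)); apply: generically_sub up _ => x.
  by rewrite {1}(size1_polyC (sp x)) hornerC.
elim=> [|N IHN] u w p q d e; first by case: d e => [|d] // [|e] // _ _ sp _ Gp _ up _; exact: base up.
wlog le_ed : u w p q d e / (e <= d)%N.
  move=> IH le_N uw sp sq Gp Gq up wq; have [le_ed | /ltnW le_de] := leqP e d.
    exact: (IH u w p q d e).
  apply: (IH w u q p e d) => //; first by rewrite addnC.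
  by apply: (generically_sub uw) => x; rewrite mulrC.
move=> le_N uw sp sq Gp Gq up wq.
case: d => [|d] in le_ed le_N sp *; first exact: base up.
case: e => [|e] in le_ed le_N sq *; first exact: base wq.
(* This is [q_0 p - p_(d+1) u^(d+1) q(1/u)]. The terms of degree [d+1] cancel, and as [q_0] has
   value 1 and [p_(d+1)] value 0, the other coefficients keep the values of those of [p]. *)
pose p' x := \poly_(i < d.+1) ((q x)`_0 * (p x)`_i - (p x)`_d.+1 * (q x)`_(d.+1 - i)).
apply: (IHN u w p' q d e.+1) => //.
- by move=> x; exact: size_poly.
- move=> i; have [i_d | d_i] := ltnP i d.+1; last first.
    rewrite gtn_eqF ?(leq_trans _ d_i) //.
    apply: (place_eqX PG (place_const PG 0)) => x _.
    by rewrite coef_poly ltnNge d_i.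
  have := place_add PG (place_mul PG (Gq 0%N) (Gp i))
           (place_opp PG (place_mul PG (Gp d.+1) (Gq (d.+1 - i)%N))).
  rewrite eqxx mul1r mul0r subr0 => H; apply: (place_eqX PG H) => x _.
  by rewrite coef_poly i_d.
- apply: (generically_and (generically_and up wq (fun x => @conj _ _)) uw).
  move=> x [ux wx] uwx.
  have -> : (p' x).[u x] = \sum_(i < d.+2)
      ((q x)`_0 * (p x)`_i - (p x)`_d.+1 * (q x)`_(d.+1 - i)) * u x ^+ i.
    by rewrite big_ord_recr /= subnn [_`_0 * _]mulrC subrr mul0r addr0 horner_poly.
  under eq_bigr => i _ do rewrite mulrBl.
  rewrite sumrB; under eq_bigr => i _ do rewrite -mulrA.
  rewrite -mulr_sumr -(horner_coef_wide _ (sp x)) ux mulr0 sub0r.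
  under eq_bigr => i _ do rewrite -mulrA.
  rewrite -mulr_sumr (_ : \sum_(i < d.+2) _ = u x ^+ d.+1 * (q x).[w x]).
    by rewrite wx !mulr0 oppr0.
  have sq' : (size (q x) <= d.+2)%N by apply: (leq_trans (sq x)).
  rewrite (horner_coef_wide _ sq') mulr_sumr (reindex_inj rev_ord_inj) /=.
  apply: eq_bigr => i _; have le_id : (i <= d.+1)%N by rewrite -ltnS.
  rewrite subSS subKn // mulrCA; congr (_ * _).
  have -> : u x ^+ d.+1 = u x ^+ (d.+1 - i) * u x ^+ i by rewrite -exprD subnK.
  by rewrite -mulrA -exprMn uwx expr1n mulr1.
Qed.

(** If neither [u] nor its inverse could be given a value, both value ideals would contain 1, and
    the two relations would contradict [value_ideal_inverse]. This is the extension step in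
    Chevalley's theorem on valuation rings. *)
Lemma place_extend G u : place G -> generically (fun x => u x != 0) ->
  exists G', [/\ place G', forall f c, G f c -> G' f c &
    (exists c, G' u c) \/ (exists c, G' (fun x => (u x)^-1) c)].
Proof.
move=> PG u0.
have ext w : ~ value_ideal G w 1 -> exists G', [/\ place G',
    forall f c, G f c -> G' f c & exists c, G' w c].
  move=> /(value_ideal_root PG)[c Ic]; exists (adjoin G w c).
  split; first exact: adjoin_place.
    by move=> f b; exact: adjoin_sub.
  by exists c; exact: adjoin_gen.
have [Iu | /ext[G' [PG' sG Gu]]] := classic (value_ideal G u 1); last first.
  by exists G'; split => //; left.
have [Iw | /ext[G' [PG' sG Gu]]] := classic (value_ideal G (fun x => (u x)^-1) 1); last first.
  by exists G'; split => //; right.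
have [p [d [sp _ Gp up]]] := Iu; have [q [e [sq _ Gq wq]]] := Iw.
have uw : generically (fun x => u x * (u x)^-1 = 1).
  by apply: (generically_sub u0) => x; exact: mulfV.
case: (@value_ideal_inverse G PG (d + e) _ _ p q d e (leqnn _) uw) => // [x|x|i|i].
- exact: leq_trans (sp x) (leqnSn _).
- exact: leq_trans (sq x) (leqnSn _).
- by have := Gp i; rewrite coef1.
- by have := Gq i; rewrite coef1.
Qed.

Lemma subspace_of_pred (vT : vectType K) (P : vT -> Prop) : P 0 ->
  (forall a (u v : vT), P u -> P v -> P (a *: u + v)) ->
  exists U : {vspace vT}, forall v, P v <-> v \in U.
Proof.
move=> P0 PD; suff: forall d (U : {vspace vT}), (\dim {:vT} - \dim U <= d)%N ->
    (forall v, v \in U -> P v) -> exists W : {vspace vT}, forall v, P v <-> v \in W.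
  move=> /(_ _ 0%VS (leqnn _)); apply => v.
  by rewrite memv0 => /eqP ->.
elim=> [|d IHd] U dU UP.
  exists U => v; split=> [_|]; last exact: UP.
  have -> : U = fullv; last exact: memvf.
  by apply/eqP; rewrite eqEdim subvf /= -subn_eq0 -leqn0.
have [[v [Pv Uv]]|all_in] := classic (exists v, P v /\ v \notin U); last first.
  exists U => v; split; last exact: UP.
  by move=> Pv; apply/negPn/negP => nU; apply: all_in; exists v.
apply: (IHd (U + <[v]>)%VS).
  have ltU : (\dim U < \dim (U + <[v]>))%N.
    rewrite ltn_neqAle dimvS ?addvSl // andbT; apply: contraNneq Uv => eqd.
    have -> : U = (U + <[v]>)%VS by apply/eqP; rewrite eqEdim addvSl eqd leqnn.
    exact: (subvP (addvSr U <[v]>) _ (memv_line v)).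
  by rewrite -ltnS; apply: leq_trans dU; rewrite ltn_sub2l // (leq_trans ltU) ?dimvS ?subvf.
move=> w /memv_addP[u Uu [_ /vlineP[a ->] ->]]; rewrite addrC.
by apply: PD => //; exact: UP.
Qed.

(** * Coordinates ordered by dominance at a place *)

Section Flag.
Variables (kap : nat) (B : 'M[K]_(kap, k)).
Hypothesis Bfree : row_free B.
Hypothesis Xmds : MDS_variety X.

Local Notation form a := (fun x : 'cV[K]_k => ((a : 'rV[K]_kap) *m (B *m x)) ord0 ord0).

(** The MDS hypothesis gives meaning to ratios of linear forms: [a *m B] is nonzero by row freeness,
    so the form does not vanish on [X]. *)
Lemma generically_form (a : 'rV[K]_kap) : a != 0 -> generically (fun x => form a x != 0).
Proof.
move=> a0; have aB0 : a *m B != 0.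
  by apply: contraNneq a0 => aB; apply/eqP/(row_free_inj Bfree); rewrite aB mul0mx.
have evE x : ev (\sum_i (a *m B) ord0 i *: 'X_i) x = form a x.
  rewrite mulmxA [RHS]mxE /ev raddf_sum; apply: eq_bigr => i _ /=.
  by rewrite mevalZ mevalXU.
exists (\sum_i (a *m B) ord0 i *: 'X_i); split.
  have [x [Xx nz]] := Xmds aB0; exists x; split=> //.
  by rewrite evE; move: nz; rewrite -mulmxA.
by move=> x _; rewrite evE.
Qed.

Lemma place_ratio1 G a : place G -> a != 0 -> G (fun x => form a x / form a x) 1.
Proof.
move=> PG a0; apply: (place_eq PG (place_const PG 1)).
by apply: (generically_sub (generically_form a0)) => x /mulfV ->.
Qed.

(** Each new form is compared with the pivot found so far. If it is the inverse of their ratio that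
    gets a value, the new form becomes the pivot, and the earlier ratios stay finite as products. *)
Lemma place_pivot_seq G (s : seq 'rV[K]_kap) : place G -> s != [::] -> 0 \notin s ->
  exists G' a, [/\ place G', forall f c, G f c -> G' f c, a \in s &
    forall e, e \in s -> exists c, G' (fun x => form e x / form a x) c].
Proof.
move=> PG; elim: s => [//|b s IHs] _; rewrite inE negb_or eq_sym => /andP[b0 s0].
have [->|sn] := eqVneq s [::].
  exists G, b; split=> //; first exact: mem_head.
  by move=> e; rewrite inE => /eqP ->; exists 1; exact: place_ratio1.
have [G1 [a [PG1 sG1 sa Ga]]] := IHs sn s0.
have a0 : a != 0 by apply: contraNneq s0 => <-.
have gab : generically (fun x => form b x / form a x != 0).
  apply: (generically_and (generically_form a0) (generically_form b0)) => x ax bx.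
  by rewrite mulf_neq0 ?invr_neq0.
have [G2 [PG2 sG2 [[c Gc]|[c Gc]]]] := place_extend PG1 gab.
  exists G2, a; split=> //.
  - by move=> f c' /sG1/sG2.
  - by rewrite inE sa orbT.
  - move=> e; rewrite inE => /predU1P[-> | /Ga[c' Gc']]; first by exists c.
    by exists c'; exact: sG2.
exists G2, b; split=> //.
- by move=> f c' /sG1/sG2.
- exact: mem_head.
- move=> e; rewrite inE => /predU1P[-> | /Ga[c' Gc']].
    by exists 1; exact: place_ratio1.
  exists (c' * c); apply: (place_eq PG2 (place_mul PG2 (sG2 _ _ Gc') Gc)).
  apply: (generically_sub (generically_form a0)) => x ax.
  by rewrite invf_div mulrA divfK.
Qed.

Lemma place_ratio_lin G (a u v : 'rV[K]_kap) l c d : place G ->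
  G (fun x => form u x / form a x) c -> G (fun x => form v x / form a x) d ->
  G (fun x => form (l *: u + v) x / form a x) (l * c + d).
Proof.
move=> PG Gu Gv.
apply: (place_eqX PG (place_add PG (place_mul PG (place_const PG l) Gu) Gv)) => x _.
by rewrite mulmxDl -scalemxAl !mxE mulrDl mulrA.
Qed.

Lemma place_ratio0 G (a : 'rV[K]_kap) : place G -> G (fun x => form 0 x / form a x) 0.
Proof.
move=> PG; apply: (place_eqX PG (place_const PG 0)) => x _.
by rewrite mul0mx mxE mul0r.
Qed.

Lemma place_pivot G (U : {vspace 'rV[K]_kap}) : place G -> U != 0%VS ->
  exists G' a, [/\ place G', forall f c, G f c -> G' f c, a \in U, a != 0 &
    forall e, e \in U -> exists c, G' (fun x => form e x / form a x) c].
Proof.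
move=> PG U0; have bU := vbasisP U; have fU := basis_free bU.
have s0 : vbasis U != [::] :> seq _.
  by rewrite -size_eq0 size_tuple dimv_eq0.
have n0 : 0 \notin vbasis U by apply/negP => /(free_not0 fU); rewrite eqxx.
have [G' [a [PG' sG sa Ga]]] := place_pivot_seq PG s0 n0.
exists G', a; split=> //; first exact: vbasis_mem.
  by apply: contraNneq n0 => <-.
move=> e Ue; rewrite (coord_vbasis Ue).
elim/big_rec: _ => [|i v _ [c Gc]]; first by exists 0; exact: place_ratio0.
have [d Gd] := Ga _ (mem_nth 0 (leq_trans (ltn_ord i) (eq_leq (esym (size_tuple (vbasis U)))))).
by exists (coord (vbasis U) i e * d + c); exact: place_ratio_lin.
Qed.

(** The forms of [U] whose ratio to a pivot [a] has value 0 make up a hyperplane [W] of [U] that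
    avoids [a]; the remaining members of the flag are chosen in [W]. *)
Lemma place_flag_seq d G (U : {vspace 'rV[K]_kap}) : place G -> \dim U = d ->
  exists G' (s : seq 'rV[K]_kap), [/\ place G', forall f c, G f c -> G' f c,
    size s = d /\ free s, {subset s <= U} &
    forall i j, (i < j < d)%N -> G' (fun x => form s`_j x / form s`_i x) 0].
Proof.
elim: d => [|d IHd] in G U * => PG dU.
  exists G, [::]; split=> //; first by rewrite nil_free.
  by move=> i j; rewrite ltn0 andbF.
have U0 : U != 0%VS by rewrite -dimv_eq0 dU.
have [G1 [a [PG1 sG1 Ua a0 Ga]]] := place_pivot PG U0.
have [W WP] : exists W : {vspace 'rV[K]_kap}, forall e,
    (e \in U /\ G1 (fun x => form e x / form a x) 0) <-> e \in W.
  apply: subspace_of_pred => [|l u v [Uu Gu] [Uv Gv]].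
    by split; [exact: mem0v | exact: place_ratio0].
  split; first by rewrite memvD // memvZ.
  by have := place_ratio_lin l PG1 Gu Gv; rewrite mulr0 addr0.
have aW : a \notin W.
  apply/negP => /WP[_ Ga0]; have /eqP := oner_neq0 K; apply.
  have := place_add PG1 (place_ratio1 PG1 a0) (place_opp PG1 Ga0).
  rewrite subr0 => /(place_inj PG1); apply; apply: generically_all => x _.
  by rewrite subrr.
have UE : U = (<[a]> + W)%VS.
  apply/eqP; rewrite eqEsubv; apply/andP; split; last first.
    rewrite subv_add -memvE Ua; apply/subvP => e /WP[] //.
  apply/subvP => e Ue; have [c Gc] := Ga e Ue.
  rewrite -[e](subrK (c *: a)) addrC memv_add ?memvZ ?memv_line //.
  apply/WP; split; first by rewrite memvB // memvZ.
  rewrite addrC -scaleNr.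
  have := place_ratio_lin (- c) PG1 (place_ratio1 PG1 a0) Gc.
  by rewrite mulr1 addNr.
have dW : \dim W = d.
  have : \dim U = (\dim <[a]> + \dim W)%N.
    rewrite UE; apply/dimv_disjoint_sum/eqP; rewrite -subv0.
    apply/subvP => e /memv_capP[/vlineP[l ->] lW]; rewrite memv0.
    have [->|l0] := eqVneq l 0; first by rewrite scale0r.
    by case/negP: aW; rewrite -[a](scalerK l0) memvZ.
  by rewrite dU dim_vline a0 add1n => -[].
have [G2 [s [PG2 sG2 [szs fs] sW flag]]] := IHd _ _ PG1 dW.
exists G2, (a :: s); split=> //.
- by move=> f c /sG1/sG2.
- rewrite /= szs free_cons fs andbT; split=> //.
  apply: contra aW; apply/subvP/span_subvP => e; exact: sW.
- move=> e; rewrite inE => /predU1P[->//|/sW/WP[]//].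
- case=> [|i] [|j] //=; rewrite ?ltnS => ij; last exact: flag.
  by have /WP[_ /sG2] := sW _ (mem_nth 0 (leq_trans ij (eq_leq (esym szs)))).
Qed.

(* Coordinates on [K^kap] in which the generic point of [B X] specialises to the
   full coordinate flag: each coordinate dominates all the following ones. *)
Lemma place_flag : exists M : 'M[K]_kap, exists G, [/\ M \in unitmx, place G &
  forall i j : 'I_kap, (i <= j)%N ->
    G (fun x => (M *m B *m x) j ord0 / (M *m B *m x) i ord0) (i == j)%:R].
Proof.
have dk : \dim {:'rV[K]_kap} = kap by rewrite dimvf dim_matrix mul1r.
have [G [s [PG _ [szs fs] _ flag]]] := place_flag_seq generic_place dk.
pose M := \matrix_(i < kap) s`_i.
have Mx x i : (M *m B *m x) i ord0 = form s`_i x.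
  by rewrite -mulmxA !mxE; apply: eq_bigr => j _; rewrite !mxE.
exists M, G; split=> //.
  rewrite -row_free_unit -kermx_eq0; apply/eqP/row_matrixP => i.
  have fs' : free (in_tuple s) by [].
  have uM : row i (kermx M) *m M = 0 by apply/sub_kermxP; exact: row_sub.
  move: (row i (kermx M)) uM => u; rewrite row0 mulmx_sum_row => /=.
  move=> uM; apply/rowP => j; rewrite mxE.
  have ltj (l : 'I_(size s)) : (l < kap)%N := leq_trans (ltn_ord l) (eq_leq szs).
  have ltj' (l : 'I_kap) : (l < size s)%N := leq_trans (ltn_ord l) (eq_leq (esym szs)).
  have /freeP/(_ (fun l => u ord0 (Ordinal (ltj l)))) := fs'.
  move=> /(_ _ (Ordinal (ltj' j))) H; apply: etrans (H _).
    by congr (u _ _); exact: val_inj.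
  rewrite -[RHS]uM (reindex (fun l : 'I_kap => Ordinal (ltj' l))) /=; last first.
    exists (fun l => Ordinal (ltj l)) => l _; exact: val_inj.
  by apply: eq_bigr => l _; rewrite rowK; congr (u _ _ *: _); exact: val_inj.
move=> i j; rewrite leq_eqVlt => /predU1P[/val_inj->|ij].
  have sj0 : s`_j != 0.
    by apply: (free_not0 fs); rewrite mem_nth // szs.
  by rewrite eqxx; apply: (place_eqX PG (place_ratio1 PG sj0)) => x _; rewrite Mx.
have -> : (i == j) = false by apply/negbTE; rewrite neq_ltn ij.
by apply: (place_eqX PG (flag i j _)) => [|x _]; rewrite ?ij ?ltn_ord // !Mx.
Qed.
End Flag.
End Place.

(** * Messages agreeing along a hypergraph *)

Section PolynomialFunctions.
Variables (K : fieldType) (k : nat).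

Definition polyfun d (f : 'cV[K]_k -> K) :=
  exists p : {mpoly K[k]}, (msize p <= d.+1)%N /\ forall x, ev p x = f x.

Lemma polyfun_eq d f g : polyfun d f -> f =1 g -> polyfun d g.
Proof. by move=> [p [sp pf]] fg; exists p; split=> // x; rewrite pf fg. Qed.

Lemma polyfun_const d c : polyfun d (fun=> c).
Proof.
exists c%:MP; split; last by move=> x; rewrite /ev mevalC.
by rewrite msizeC; case: (c == 0).
Qed.

Lemma polyfun_add d f g : polyfun d f -> polyfun d g -> polyfun d (fun x => f x + g x).
Proof.
move=> [p [sp pf]] [q [sq qg]]; exists (p + q); split.
  by apply: (leq_trans (msizeD_le _ _)); rewrite geq_max sp sq.
by move=> x; rewrite /ev mevalD -/(ev p x) -/(ev q x) pf qg.
Qed.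

Lemma polyfun_mul d e f g : polyfun d f -> polyfun e g ->
  polyfun (d + e) (fun x => f x * g x).
Proof.
move=> [p [sp pf]] [q [sq qg]]; exists (p * q); split; last first.
  by move=> x; rewrite /ev mevalM -/(ev p x) -/(ev q x) pf qg.
have [->|p0] := eqVneq p 0; first by rewrite mul0r msize0.
have [->|q0] := eqVneq q 0; first by rewrite mulr0 msize0.
rewrite msizeM // -ltnS prednK.
  by rewrite -addSn -addnS leq_add.
by rewrite addn_gt0 lt0n msize_poly_eq0 p0.
Qed.

Lemma polyfun_sum d (I : Type) (r : seq I) (f : I -> 'cV[K]_k -> K) :
  (forall i, polyfun d (f i)) -> polyfun d (fun x => \sum_(i <- r) f i x).
Proof.
move=> pf; elim: r => [|i r IHr].
  by apply: polyfun_eq (polyfun_const d 0) _ => x; rewrite big_nil.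
by apply: polyfun_eq (polyfun_add (pf i) IHr) _ => x; rewrite big_cons.
Qed.

Lemma polyfun_coord i : polyfun 1 (fun x => x i ord0).
Proof.
by exists 'X_i; split=> [|x]; rewrite ?/ev ?mevalXU // msizeX mdeg1.
Qed.

Lemma polyfun_mulmx m (M : 'M[K]_(m, k)) i : polyfun 1 (fun x => (M *m x) i ord0).
Proof.
apply: (@polyfun_eq _ (fun x => \sum_j M i j * x j ord0)); last by move=> x; rewrite mxE.
by apply: polyfun_sum => j; apply: (@polyfun_mul 0 1); [exact: polyfun_const | exact: polyfun_coord].
Qed.

Lemma polyfun_det d (M : 'cV[K]_k -> 'M[K]_d) :
  (forall i j, polyfun 1 (fun x => M x i j)) -> polyfun d (fun x => \det (M x)).
Proof.
move=> pM; apply: polyfun_sum => s.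
rewrite -[d]/(0 + d)%N; apply: polyfun_mul; first exact: polyfun_const.
have prodP (g : 'I_d -> 'I_d) (r : seq 'I_d) :
    polyfun (size r) (fun x => \prod_(i <- r) M x i (g i)).
  elim: r => [|i r IHr] /=.
    by apply: polyfun_eq (polyfun_const 0 1) _ => x; rewrite big_nil.
  rewrite -add1n; apply: polyfun_eq (polyfun_mul (pM i (g i)) IHr) _ => x.
  by rewrite big_cons.
by have := prodP s (index_enum 'I_d); rewrite /index_enum -enumT size_enum_ord.
Qed.

End PolynomialFunctions.

Lemma col_minor (K : fieldType) d t (M : 'M[K]_(d, t)) : row_free M ->
  exists f : 'I_d -> 'I_t, injective f /\ \det (colsub f M) != 0.
Proof.
rewrite -row_leq_rank -mxrank_tr => rk; have rf : row_full M^T.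
  by rewrite /row_full eqn_leq rank_leq_col.
exists (fullrankfun rf); split; first exact: fullrankfun_inj.
have := fullrowsub_unit rf; rewrite unitmxE unitfE -det_tr.
by congr (_ != 0); congr (\det _); apply/matrixP => i j; rewrite !mxE.
Qed.

Lemma inj_avoid_ltn d t (f : 'I_d -> 'I_t) r : injective f -> (forall i, f i != r) ->
  (d < t)%N.
Proof.
move=> f_inj fr; rewrite -[t]card_ord (cardD1 r) inE ltnS -[d]card_ord -(card_image f_inj).
by apply/subset_leq_card/subsetP => _ /imageP[i _ ->]; rewrite !inE fr.
Qed.

(** * Linear conditions on the messages *)

Section Systems.
Variables (K : closedFieldType) (k kap t : nat).
Implicit Types (J e : {set 'I_t}) (lev : 'I_t -> nat) (m : 'M[K]_(t, kap)).
Implicit Types (s : seq ({set 'I_t} * 'cV[K]_k)) (B : 'M[K]_(kap, k)).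

(* The rows of [m] are messages indexed by vertices.  A vertex of level [a] has
   its first [a] coordinates tied to those of the other vertices; a pair [(e, z)]
   of [s] asks the messages in [e] to agree at the point [z]. *)
Definition compatible B J lev s m :=
  (forall (a : 'I_kap) v w, v \in J -> w \in J -> (a < lev v)%N -> (a < lev w)%N ->
     m v a = m w a) /\
  (forall ez, ez \in s -> forall v w, v \in ez.1 :&: J -> w \in ez.1 :&: J ->
     (m *m (B *m ez.2)) v ord0 = (m *m (B *m ez.2)) w ord0).

Definition rigid B J lev s :=
  forall m, compatible B J lev s m -> forall v w, v \in J -> w \in J -> row v m = row w m.

Lemma compatible_lin B J lev s a m1 m2 : compatible B J lev s m1 ->
  compatible B J lev s m2 -> compatible B J lev s (a *: m1 + m2).
Proof.
move=> [l1 e1] [l2 e2]; split=> [c v w Jv Jw cv cw|ez sez v w ev ew].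
  by rewrite !mxE (l1 c v w) ?(l2 c v w).
have mE u : ((a *: m1 + m2) *m (B *m ez.2)) u ord0 =
    a * (m1 *m (B *m ez.2)) u ord0 + (m2 *m (B *m ez.2)) u ord0.
  by rewrite mulmxDl -scalemxAl mxE; congr (_ + _); rewrite mxE.
by rewrite !mE (e1 ez sez v w) ?(e2 ez sez v w).
Qed.

Lemma compatible_cons B J lev s e z m : compatible B J lev ((e, z) :: s) m <->
  compatible B J lev s m /\ forall v w, v \in e :&: J -> w \in e :&: J ->
     (m *m (B *m z)) v ord0 = (m *m (B *m z)) w ord0.
Proof.
split=> [[l c]|[[l c] cz]].
  split; last exact: (c (e, z) (mem_head _ _)).
  by split=> // ez sez; apply: c; rewrite inE sez orbT.
split=> // ez; rewrite inE => /predU1P[->|]; [exact: cz | exact: c].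
Qed.

Lemma compatible_sub B J lev s s' m : {subset s <= s'} ->
  compatible B J lev s' m -> compatible B J lev s m.
Proof. by move=> ss' [l c]; split=> // ez /ss'; exact: c. Qed.

Lemma rigid_sub B J lev s s' : {subset s <= s'} -> rigid B J lev s -> rigid B J lev s'.
Proof. by move=> ss' rs m /(compatible_sub ss'); exact: rs. Qed.

Definition pinned B J lev s r m := [/\ compatible B J lev s m,
  forall v, v \notin J -> row v m = 0 & row r m = 0].

Lemma pinned_space B J lev s r :
  exists U : {vspace 'M[K]_(t, kap)}, forall m, pinned B J lev s r m <-> m \in U.
Proof.
apply: subspace_of_pred => [|a m1 m2 [c1 o1 r1] [c2 o2 r2]].
  split=> [|v _|]; rewrite ?row0 //; split=> *; rewrite ?mul0mx !mxE //.
split=> [|v Jv|]; rewrite ?linearP /= ?r1 ?r2 ?o1 ?o2 ?scaler0 ?addr0 //.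
exact: compatible_lin.
Qed.

Definition injective_at B (U : {vspace 'M[K]_(t, kap)}) e (z : 'cV[K]_k) :=
  forall m, m \in U -> (forall v, v \in e -> (m *m (B *m z)) v ord0 = 0) -> m = 0.

(** Subtracting the message at [r] from all messages of [J] turns equality into vanishing, so
    rigidity becomes injectivity of the linear evaluation map at [z] on [U]. *)
Lemma rigid_injective_at B J lev s r e z (U : {vspace 'M[K]_(t, kap)}) :
  r \in e :&: J -> (forall m, pinned B J lev s r m <-> m \in U) ->
  rigid B J lev ((e, z) :: s) <-> injective_at B U (e :&: J) z.
Proof.
move=> reJ UP; have /setIP[re rJ] := reJ; split=> [rig m /UP[cm om rm] mz|inj m].
  apply/row_matrixP => v; rewrite row0; have [Jv|] := boolP (v \in J); last exact: om.
  rewrite -rm; apply: rig => //; apply/compatible_cons; split=> // v' w ev ew.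
  by rewrite !mz.
move=> /compatible_cons[[lm cm] mz].
pose m' := \matrix_(v, a) (if v \in J then m v a - m r a else 0).
have m'E v (y : 'cV[K]_kap) : v \in J -> (m' *m y) v ord0 = (m *m y) v ord0 - (m *m y) r ord0.
  move=> Jv; rewrite !mxE -sumrB; apply: eq_bigr => a _.
  by rewrite !mxE Jv mulrBl.
suff m'0 : m' = 0.
  have mr v : v \in J -> row v m = row r m.
    move=> Jv; apply/rowP => a; have /matrixP/(_ v a) := m'0.
    by rewrite !mxE Jv => /eqP; rewrite subr_eq0 => /eqP.
  by move=> v w /mr -> /mr ->.
apply: inj.
  apply/UP; split=> [|v Jv|].
  - split=> [a v w Jv Jw av aw|ez sez v w ev ew].
      by rewrite !mxE Jv Jw (lm a v w).
    have /setIP[_ Jv] := ev; have /setIP[_ Jw] := ew.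
    by rewrite !m'E // (cm ez sez v w).
  - by apply/rowP => a; rewrite !mxE (negPf Jv).
  - by apply/rowP => a; rewrite !mxE rJ subrr.
move=> v ev; have /setIP[_ Jv] := ev.
by rewrite m'E // (mz v r) // subrr.
Qed.

Lemma vbasis_comb (vT : vectType K) (U : {vspace vT}) (u : 'rV[K]_(\dim U)) :
  (\sum_i u ord0 i *: (vbasis U)`_i = 0 -> u = 0) /\
  \sum_i u ord0 i *: (vbasis U)`_i \in U.
Proof.
split=> [u0|]; last first.
  by apply: memv_suml => i _; rewrite memvZ // vbasis_mem // mem_nth // size_tuple.
have /freeP fU := basis_free (vbasisP U).
by apply/rowP => i; rewrite mxE (fU (fun i => u ord0 i)).
Qed.

(** Injectivity is witnessed by a nonzero maximal minor of the evaluation matrix [Phi]. The column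
    of [r] in [Phi] is zero, so the minor has at most [t - 1] columns, with entries linear in [z];
    for [t = L + 1] this gives the degree bound [L]. *)
Lemma injective_at_open B (U : {vspace 'M[K]_(t, kap)}) e r z0 :
  (forall m, m \in U -> row r m = 0) -> injective_at B U e z0 ->
  exists p : {mpoly K[k]}, [/\ (msize p <= t)%N, ev p z0 != 0 &
    forall z, ev p z != 0 -> injective_at B U e z].
Proof.
move=> Ur inj0.
pose Phi (z : 'cV[K]_k) := \matrix_(i < \dim U, v < t)
  (if v \in e then ((vbasis U)`_i *m (B *m z)) v ord0 else 0).
have PhiE z (u : 'rV_(\dim U)) v : v \in e ->
    (u *m Phi z) ord0 v = ((\sum_i u ord0 i *: (vbasis U)`_i) *m (B *m z)) v ord0.
  move=> ev; rewrite mulmx_suml summxE mxE; apply: eq_bigr => i _.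
  by rewrite -scalemxAl !mxE ev.
have free0 : row_free (Phi z0).
  rewrite -kermx_eq0; apply/eqP/row_matrixP => i; rewrite row0.
  have uM : row i (kermx (Phi z0)) *m Phi z0 = 0 by apply/sub_kermxP; exact: row_sub.
  move: (row i _) uM => u uM; have [u0 uU] := vbasis_comb u.
  apply: u0; apply: inj0 => // v ev; by rewrite -PhiE // uM mxE.
have [f [f_inj det0]] := col_minor free0.
have fr i : f i != r.
  apply: contraNneq det0 => fir; rewrite (expand_det_col _ i) big1 // => j _.
  rewrite 2!mxE fir (_ : (if _ then _ else _) = 0) ?mul0r //; case: ifP => // _.
  have bU : (vbasis U)`_j \in U by rewrite vbasis_mem // mem_nth // size_tuple.
  have := congr1 (fun a => (a *m (B *m z0)) ord0 ord0) (Ur _ bU).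
  by rewrite -row_mul mul0mx !mxE.
have le_t := inj_avoid_ltn f_inj fr.
have [|p [sp pE]] := @polyfun_det K k _ (fun z => colsub f (Phi z)).
  move=> i j; case: (boolP (f j \in e)) => fj.
    apply: polyfun_eq (polyfun_mulmx ((vbasis U)`_i *m B) (f j)) _ => x.
    by rewrite -mulmxA !mxE fj.
  by apply: polyfun_eq (polyfun_const _ _ 0) _ => x; rewrite !mxE (negPf fj).
exists p; split; first exact: leq_trans sp le_t.
  by rewrite pE.
move=> z; rewrite pE => detz m mU mz.
have mE : m = \sum_i (\row_i coord (vbasis U) i m) ord0 i *: (vbasis U)`_i.
  by rewrite {1}(coord_vbasis mU); apply: eq_bigr => i _; rewrite mxE.
move: (\row_i _) mE => u mE.
have uM : u *m colsub f (Phi z) = 0.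
  rewrite mulmx_colsub; apply/rowP => j; rewrite 2!mxE [RHS]mxE.
  have [fj|fj] := boolP (f j \in e); last first.
    by rewrite big1 // => i _; rewrite mxE (negPf fj) mulr0.
  by have := PhiE z u (f j) fj; rewrite -mE mz // mxE.
have u0 : u = 0.
  apply: (row_free_inj (A := colsub f (Phi z))); last by rewrite uM mul0mx.
  by rewrite row_free_unit unitmxE unitfE.
by rewrite mE big1 // => i _; rewrite u0 mxE scale0r.
Qed.

Lemma rigid_open B J lev s e z0 : (0 < t)%N -> rigid B J lev ((e, z0) :: s) ->
  exists p : {mpoly K[k]}, [/\ (msize p <= t)%N, ev p z0 != 0 &
    forall z, ev p z != 0 -> rigid B J lev ((e, z) :: s)].
Proof.
move=> t0 rig; have [eJ0|[r reJ]] := set_0Vmem (e :&: J).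
  exists 1; split; first by rewrite msize1.
    by rewrite /ev meval1 oner_eq0.
  move=> z _ m /compatible_cons[cm _]; apply: rig; apply/compatible_cons; split=> //.
  by move=> v w; rewrite eJ0 inE.
have [U UP] := pinned_space B J lev s r.
have Ur m : m \in U -> row r m = 0 by case/UP.
have /(rigid_injective_at _ reJ UP) inj0 := rig.
have [p [sp p0 pinj]] := injective_at_open Ur inj0.
by exists p; split=> // z /pinj; exact: (rigid_injective_at _ reJ UP).2.
Qed.

(** * Specialising a point to the centre of a place *)

Section Degeneration.
Variables (X : 'cV[K]_k -> Prop) (G : ('cV[K]_k -> K) -> K -> Prop).
Hypotheses (Xprime : prime_locus X) (PG : place X G).

Definition flagged B := forall i j : 'I_kap, (i <= j)%N ->
  G (fun x => (B *m x) j ord0 / (B *m x) i ord0) (i == j)%:R.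

(* Specialising the point of [e] to the centre of the place replaces each of its
   conditions by the vanishing of the first coordinate not yet known to vanish. *)
Lemma rigid_degeneration B J lev s e r : flagged B ->
  r \in e :&: J -> (kap <= lev r)%N ->
  (forall v, v \in (e :&: J) :\ r -> (lev v < kap)%N) ->
  rigid B J (fun v => (v \in (e :&: J) :\ r) + lev v)%N s ->
  exists z, X z /\ rigid B J lev ((e, z) :: s).
Proof.
set A := (e :&: J) :\ r => Bflag reJ lev_r levA rig; have /setIP[re rJ] := reJ.
have [U UP] := pinned_space B J lev s r.
have U0 m v (a : 'I_kap) : m \in U -> v \in J -> (a < lev v)%N -> m v a = 0.
  move=> /UP[[lm _] _ rm] Jv lt_av; rewrite (lm a v r) ?(leq_trans _ lev_r) //.
  by move/rowP/(_ a): rm; rewrite !mxE.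
have AJ : {subset A <= J} by move=> v /setDP[/setIP[]].
(* The coordinate killed at [v]: with indices from 0, the first one beyond the [lev v] tied
   coordinates has index [lev v]. *)
pose c_ v : option 'I_kap := if v \in A then insub (lev v) else None.
have c_S v c : c_ v = Some c -> v \in A /\ lev v = c.
  by rewrite /c_; case: ifP => // vA; case: insubP => // c' _ <- [<-].
have c_A v : v \in A -> exists2 c, c_ v = Some c & lev v = c.
  move=> vA; have lev_v := levA v vA; exists (Ordinal lev_v) => //.
  by rewrite /c_ vA insubT.
pose b i := (vbasis U)`_i.
have bU (i : 'I_(\dim U)) : b i \in U by rewrite vbasis_mem // mem_nth // size_tuple.
pose Phi0 := \matrix_(i < \dim U, v < t) oapp (fun c => b i v c) 0 (c_ v).
(* Dividing the condition at [v] by the coordinate [c_ v] of the point makes the place finite on it: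
   earlier coordinates of the message vanish on [U] and later ratios have value 0, so the value is
   the entry of [Phi0]. *)
pose Psi (x : 'cV[K]_k) := \matrix_(i < \dim U, v < t)
  oapp (fun c => (b i *m (B *m x)) v ord0 / (B *m x) c ord0) 0 (c_ v).
have GPsi i v : G (fun x => Psi x i v) (Phi0 i v).
  rewrite mxE; case cv: (c_ v) => [c|] /=; last first.
    by apply: (place_eqX Xprime PG (place_const PG 0)) => x _; rewrite mxE cv.
  have [vA lev_v] := c_S _ _ cv.
  have -> : b i v c = \sum_a b i v a * (c == a)%:R.
    rewrite (bigD1 c) //= eqxx mulr1 big1 ?addr0 // => a /negPf.
    by rewrite eq_sym => ->; rewrite mulr0.
  apply: (place_eqX Xprime PG (f := fun x =>
     \sum_a b i v a * ((B *m x) a ord0 / (B *m x) c ord0))) => [|x _]; last first.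
    by rewrite [RHS]mxE cv /= [X in _ = X / _]mxE mulr_suml; apply: eq_bigr => a _; rewrite mulrA.
  apply: (place_sum Xprime _ PG) => a _.
  have [ac|ca] := ltnP a c.
    rewrite (U0 _ v a) ?AJ ?lev_v // mul0r.
    by apply: (place_eqX Xprime PG (place_const PG 0)) => x _; rewrite mul0r.
  by apply: (place_mul PG (place_const PG _)); exact: Bflag.
have mE (u : 'rV_(\dim U)) v : (u *m Phi0) ord0 v =
    oapp (fun c => (\sum_i u ord0 i *: b i) v c) 0 (c_ v).
  rewrite mxE; case cv: (c_ v) => [c|] /=.
    by rewrite summxE; apply: eq_bigr => i _; rewrite !mxE cv.
  by rewrite big1 // => i _; rewrite mxE cv mulr0.
have free0 : row_free Phi0.
  rewrite -kermx_eq0; apply/eqP/row_matrixP => i; rewrite row0.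
  have uM : row i (kermx Phi0) *m Phi0 = 0 by apply/sub_kermxP; exact: row_sub.
  move: (row i _) uM => u uM; have [u0 uU] := vbasis_comb u; apply: u0.
  move: uU (mE u); rewrite uM; set m := \sum_i _ => mU m0.
  have mv0 v (a : 'I_kap) : v \in J -> (a < (v \in A) + lev v)%N -> m v a = 0.
    move=> Jv; have [av _|le_a] := ltnP a (lev v); first exact: U0.
    have [vA|_] := boolP (v \in A); last by rewrite ltnNge le_a.
    rewrite add1n ltnS => ge_a; have [c cv lev_v] := c_A v vA.
    have := m0 v; rewrite cv /= mxE => ->; congr (m v _).
    by apply: val_inj => /=; rewrite -lev_v; apply/eqP; rewrite eqn_leq ge_a.
  have [[_ cm] om rm] := (UP m).2 mU.
  apply/row_matrixP => v; rewrite row0; have [Jv|] := boolP (v \in J); last exact: om.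
  rewrite -rm; apply: rig => //; split=> // a v' w Jv' Jw av' aw.
  by rewrite !mv0.
have [f [_ det0]] := col_minor free0.
(* If this minor of [Psi] vanished on all of [X], its value [\det (colsub f Phi0)] at the place
   would be 0. *)
have [z [Xz detz]] : exists z, X z /\ \det (colsub f (Psi z)) != 0.
  apply: NNPP => no; case/eqP: det0.
  have Gdet := place_det Xprime (M := fun x => colsub f (Psi x)) (N := colsub f Phi0) PG.
  apply: (place_inj PG (Gdet _)) => [i j|].
    rewrite mxE; apply: (place_eqX Xprime PG (GPsi i (f j))) => x _.
    by rewrite [RHS]mxE.
  apply: (generically_all Xprime) => x Xx; apply/eqP/negPn/negP => nz.
  by case: no; exists x.
exists z; split=> //; apply/(rigid_injective_at _ reJ UP) => m mU mz.
have mEU : m = \sum_i (\row_i coord (vbasis U) i m) ord0 i *: (vbasis U)`_i.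
  by rewrite {1}(coord_vbasis mU); apply: eq_bigr => i _; rewrite mxE.
move: (\row_i _) mEU => u mEU.
suff u0 : u = 0 by rewrite mEU big1 // => i _; rewrite u0 mxE scale0r.
apply: (row_free_inj (A := colsub f (Psi z))).
  by rewrite row_free_unit unitmxE unitfE.
rewrite mul0mx mulmx_colsub; apply/rowP => j; rewrite 2!mxE [RHS]mxE.
case cv: (c_ (f j)) => [c|]; last first.
  by rewrite big1 // => i _; rewrite mxE cv mulr0.
have [/setDP[fA _] _] := c_S _ _ cv; have := mz _ fA; rewrite mEU mulmx_suml summxE => mz0.
transitivity ((\sum_i ((u ord0 i *: b i) *m (B *m z)) (f j) ord0) / (B *m z) c ord0).
  rewrite mulr_suml; apply: eq_bigr => i _.
  by rewrite mxE cv /= mulrA -scalemxAl; congr (_ / _); rewrite [RHS]mxE.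
by rewrite mz0 mul0r.
Qed.

End Degeneration.

(* The two lists are made equal one point at a time, by irreducibility of [X]. *)
Lemma common_points (X : 'cV[K]_k -> Prop) (Q1 Q2 : seq 'cV[K]_k -> Prop) p1 p2 :
  prime_locus X ->
  (forall p z0 p', Q1 (p ++ z0 :: p') -> exists f : {mpoly K[k]},
     ev f z0 != 0 /\ forall z, ev f z != 0 -> Q1 (p ++ z :: p')) ->
  (forall p z0 p', Q2 (p ++ z0 :: p') -> exists f : {mpoly K[k]},
     ev f z0 != 0 /\ forall z, ev f z != 0 -> Q2 (p ++ z :: p')) ->
  size p1 = size p2 -> (forall z, z \in p1 -> X z) -> (forall z, z \in p2 -> X z) ->
  Q1 p1 -> Q2 p2 ->
  exists p, [/\ size p = size p1, forall z, z \in p -> X z, Q1 p & Q2 p].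
Proof.
move=> Xprime open1 open2.
suff gen pre : size p1 = size p2 -> (forall z, z \in p1 -> X z) ->
    (forall z, z \in p2 -> X z) -> Q1 (pre ++ p1) -> Q2 (pre ++ p2) ->
    exists p, [/\ size p = size p1, forall z, z \in p -> X z, Q1 (pre ++ p) & Q2 (pre ++ p)].
  exact: (gen [::]).
elim: p1 p2 pre => [|z1 p1 IH] [|z2 p2] pre // => [_ _ _ Q1p Q2p|[sz] X1 X2 Q1p Q2p].
  by exists [::].
have [f1 [f1z1 Q1f]] := open1 _ _ _ Q1p; have [f2 [f2z2 Q2f]] := open2 _ _ _ Q2p.
have [||z [Xz f1z f2z]] := Xprime.2 f1 f2.
- by exists z1; split; first exact/X1/mem_head.
- by exists z2; split; first exact/X2/mem_head.
have [||||p [szp Xp Q1' Q2']] := IH p2 (rcons pre z) sz.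
- by move=> y yp; apply: X1; rewrite inE yp orbT.
- by move=> y yp; apply: X2; rewrite inE yp orbT.
- by rewrite cat_rcons; exact: Q1f.
- by rewrite cat_rcons; exact: Q2f.
exists (z :: p); split; rewrite ?cat_rcons //= ?szp //; last 2 first.
- by rewrite cat_rcons in Q1'.
- by rewrite cat_rcons in Q2'.
by move=> y; rewrite inE => /predU1P[->|/Xp].
Qed.

End Systems.

(** * Partition connected hypergraphs *)

Section Hypergraphs.
Local Open Scope nat_scope.
Variable T : finType.
Implicit Types (A J S : {set T}) (fam : seq {set T}) (lev : T -> nat).

Definition weight fam S := \sum_(A <- fam) #|A :&: S|.-1.

Lemma weight_cat fam1 fam2 S : weight (fam1 ++ fam2) S = weight fam1 S + weight fam2 S.
Proof. by rewrite /weight big_cat. Qed.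

Lemma weight_cons A fam S : weight (A :: fam) S = #|A :&: S|.-1 + weight fam S.
Proof. by rewrite /weight big_cons. Qed.

(* A map [f] encodes the partition of [J] into its fibres. *)
Definition partition_connected q fam J :=
  forall f : T -> T, q * #|f @: J|.-1 <= \sum_(A <- fam) #|f @: (A :&: J)|.-1.

(** Each fibre that meets [A] contributes its share of [A] less one, and [#|f @: A|] fibres meet
    [A]. *)
Lemma card_fibres (f : T -> T) A J : A \subset J ->
  #|A|.-1 = \sum_(u in f @: J) #|A :&: (f @^-1: [set u])|.-1 + #|f @: A|.-1.
Proof.
move=> AJ; have [->|/set0Pn[x Ax]] := eqVneq A set0.
  by rewrite imset0 cards0 big1 // => u _; rewrite set0I cards0.
have cardE : #|A| = \sum_(u in f @: J) #|A :&: (f @^-1: [set u])|.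
  rewrite -sum1_card (partition_big f (mem (f @: J))) => [|y Ay]; last exact/imset_f/(subsetP AJ).
  by apply: eq_bigr => u _; rewrite -sum1_card; apply: eq_bigl => y; rewrite !inE.
have imE : #|f @: A| = \sum_(u in f @: J) (0 < #|A :&: (f @^-1: [set u])|).
  rewrite -sum1_card big_mkcond [RHS]big_mkcond; apply: eq_bigr => u _.
  have -> : (u \in f @: A) = (u \in f @: J) && (0 < #|A :&: (f @^-1: [set u])|).
    apply/idP/andP => [/imsetP[y Ay ->]|[_ /card_gt0P[y]]].
      split; first exact/imset_f/(subsetP AJ).
      by apply/card_gt0P; exists y; rewrite !inE Ay eqxx.
    by rewrite !inE => /andP[Ay /eqP <-]; exact: imset_f.
  by case: (u \in f @: J) => //=; case: (_ < _).
have : #|A| = \sum_(u in f @: J) #|A :&: (f @^-1: [set u])|.-1 + #|f @: A|.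
  by rewrite imE -big_split cardE /=; apply: eq_bigr => u _; case: #|_| => // c; rewrite addn1.
have : 0 < #|f @: A| by apply/card_gt0P; exists (f x); exact: imset_f.
lia.
Qed.

(** By [card_fibres] the weight of [J] is the weight inside the parts plus the number of crossings.
    The parts are proper subsets, hence light, and the crossings must supply the rest. *)
Lemma partition_connected_of_weight q fam J :
  q * #|J|.-1 <= weight fam J ->
  (forall S, S \proper J -> 1 < #|S| -> weight fam S <= q * #|S|.-1) ->
  partition_connected q fam J.
Proof.
move=> wJ wS f; have [fJ1|fJ2] := leqP #|f @: J| 1.
  by rewrite (_ : _.-1 = 0) ?muln0 //; case: #|_| fJ1 => [|[]].
pose P u := J :&: (f @^-1: [set u]).
have Pproper u : P u \proper J.
  rewrite properE subsetIl; apply: contraL fJ2 => JP; rewrite -leqNgt -(cards1 u).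
  apply/subset_leq_card/subsetP => _ /imsetP[x Jx ->].
  by move/(subsetP JP): Jx; rewrite !inE => /andP[].
have wP u : weight fam (P u) <= q * #|P u|.-1.
  have [P1|P2] := leqP #|P u| 1; last exact: wS.
  rewrite /weight big1 // => A _; have := leq_trans (subset_leq_card (subsetIr A (P u))) P1.
  by case: #|_| => [|[]].
have wE : weight fam J = \sum_(u in f @: J) weight fam (P u)
                        + \sum_(A <- fam) #|f @: (A :&: J)|.-1.
  rewrite exchange_big -big_split; apply: eq_bigr => A _ /=.
  rewrite (card_fibres f (subsetIr A J)); congr (_ + _).
  by apply: eq_bigr => u _; rewrite setIA.
have JE := card_fibres f (subxx J).
have : \sum_(u in f @: J) weight fam (P u) <= q * \sum_(u in f @: J) #|P u|.-1.
  by rewrite big_distrr; apply: leq_sum.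
move: wJ; rewrite wE JE mulnDr => wJ wP'.
rewrite -(leq_add2l (q * \sum_(u in f @: J) #|P u|.-1)); apply: leq_trans wJ _.
by rewrite leq_add2r.
Qed.

(** Edge number [a] joins the vertices whose coordinate [a] is tied, so that tied coordinates count
    as edges beside those of the hypergraph. *)
Definition levels n lev := [seq [set v | a < lev v] | a <- iota 0 n].

Lemma sum_ltn n x : \sum_(a < n) (a < x) = minn n x.
Proof.
elim: n => [|n IHn]; first by rewrite big_ord0 min0n.
by rewrite big_ord_recr /= IHn; lia.
Qed.

(** Every nonempty level edge loses one in the weight, and the number of those meeting [S] is the
    largest level on [S]. *)
Lemma weight_levels n lev S : {in S, forall v, lev v <= n} ->
  weight (levels n lev) S + \max_(v in S) lev v = \sum_(v in S) lev v.
Proof.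
move=> lev_n; have max_n : \max_(v in S) lev v <= n by apply/bigmax_leqP.
have <- : \sum_(a < n) (a < \max_(v in S) lev v) = \max_(v in S) lev v.
  by rewrite sum_ltn; apply/minn_idPr.
rewrite /weight big_map -[iota 0 n](_ : index_iota 0 n = _) ?big_mkord; last first.
  by rewrite /index_iota subn0.
rewrite -big_split /=.
transitivity (\sum_(a < n) #|[set v | a < lev v] :&: S|).
  apply: eq_bigr => a _; rewrite (_ : (_ < \max_(v in S) _) = (0 < #|[set v | a < lev v] :&: S|)).
    by case: #|_|; lia.
  apply/idP/card_gt0P => [lt_a|[v]]; last first.
    by rewrite !inE => /andP[av Sv]; apply: leq_trans av _; exact: leq_bigmax_cond.
  have S0 : 0 < #|S|.
    by rewrite card_gt0; apply: contraTneq lt_a => ->; rewrite big_set0.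
  have [v Sv mE] := eq_bigmax_cond lev S0.
  by exists v; rewrite !inE Sv -mE lt_a.
transitivity (\sum_(a < n) \sum_(v in S) (a < lev v)).
  apply: eq_bigr => a _; rewrite -sum1_card big_mkcond [RHS]big_mkcond.
  by apply: eq_bigr => v _; rewrite !inE andbC; case: (v \in S); case: (a < _).
rewrite exchange_big; apply: eq_bigr => v Sv /=.
by rewrite sum_ltn; apply/minn_idPr/lev_n.
Qed.

End Hypergraphs.

Lemma mem_zip_map (S T U : eqType) (g : S -> T) (l : seq S) (p : seq U) y z :
  (y, z) \in zip (map g l) p -> exists2 x, (x, z) \in zip l p & y = g x.
Proof.
elim: l p => [|x l IHl] [|z' p] //=; rewrite inE xpair_eqE => /orP[/andP[/eqP-> /eqP->]|].
  by exists x; rewrite ?mem_head.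
by move=> /IHl[x' xz ->]; exists x'; rewrite // inE xz orbT.
Qed.

(** * Rigidity of partition connected hypergraphs at generic points *)

Section GenericRigidity.
Variables (K : closedFieldType) (k kap t : nat) (X : 'cV[K]_k -> Prop).
Variables (G : ('cV[K]_k -> K) -> K -> Prop) (B : 'M[K]_(kap, k)).
Hypotheses (Xprime : prime_locus X) (PG : place X G) (Bflag : flagged G B).
Implicit Types (J S e : {set 'I_t}) (lev : 'I_t -> nat) (l : seq {set 'I_t}).

Lemma rigid_zip_open J lev l p z0 p' : (0 < t)%N -> size (p ++ z0 :: p') = size l ->
  rigid B J lev (zip l (p ++ z0 :: p')) -> exists f : {mpoly K[k]},
    ev f z0 != 0 /\ forall z, ev f z != 0 -> rigid B J lev (zip l (p ++ z :: p')).
Proof.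
move=> t0 szl rig.
have [e [l1 [l2 [lE sz1]]]] : exists e l1 l2, l = l1 ++ e :: l2 /\ size l1 = size p.
  have ltp : (size p < size l)%N by rewrite -szl size_cat addnS ltnS leq_addr.
  exists (nth set0 l (size p)), (take (size p) l), (drop (size p).+1 l).
  by rewrite -drop_nth // cat_take_drop size_takel // ltnW.
have memE z : zip l (p ++ z :: p') =i (e, z) :: zip l1 p ++ zip l2 p'.
  by move=> y; rewrite lE zip_cat //= mem_cat !inE mem_cat orbCA.
have sub z : {subset (e, z) :: zip l1 p ++ zip l2 p' <= zip l (p ++ z :: p')}.
  by move=> y; rewrite memE.
have rig0 : rigid B J lev ((e, z0) :: zip l1 p ++ zip l2 p').
  by apply: rigid_sub rig => y; rewrite memE.
have [f [_ f0 rigf]] := rigid_open t0 rig0.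
by exists f; split=> // z /rigf; apply: rigid_sub.
Qed.

Section Contraction.
Variables (J S : {set 'I_t}) (v0 : 'I_t).
Hypotheses (SJ : S \subset J) (Sv0 : v0 \in S).

Let c v := if v \in S then v0 else v.
Definition contract_lev lev v' := (\max_(v in J | c v == v') lev v)%N.
Definition contract_edges l := [seq c @: (A :&: J) | A <- l].

Let cJ v : v \in J -> c v \in J.
Proof. by rewrite /c; case: ifP => // _ _; exact: (subsetP SJ). Qed.

Lemma contract_card : (1 < #|S|)%N -> (#|c @: J| < #|J|)%N.
Proof.
move=> /card_gt1P[x [y [Sx Sy xy]]]; rewrite ltn_neqAle leq_imset_card andbT.
apply: contra xy => /imset_injP c_inj; apply/eqP/c_inj; try exact: (subsetP SJ).
by rewrite /c Sx Sy.
Qed.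

Lemma contract_lev_gt lev a v' :
  reflect (exists v, [/\ v \in J, c v = v' & (a < lev v)%N]) (a < contract_lev lev v')%N.
Proof.
apply: (iffP idP) => [lt_a|[v [Jv cv av]]]; last first.
  apply: leq_trans av _; rewrite /contract_lev.
  by apply: (leq_bigmax_cond (P := fun v => (v \in J) && (c v == v')));  rewrite Jv cv eqxx.
have S0 : (0 < #|[pred v | (v \in J) && (c v == v')]|)%N.
  rewrite lt0n; apply: contraTneq lt_a => /card0_eq E.
  by rewrite /contract_lev big_pred0 // => v; exact: E.
have [v /andP[Jv /eqP cv] E] := eq_bigmax_cond lev S0.
by exists v; split=> //; rewrite -E.
Qed.

Lemma contract_lev_le lev n : {in J, forall v, lev v <= n}%N ->
  {in c @: J, forall v, contract_lev lev v <= n}%N.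
Proof. by move=> lev_n v _; apply/bigmax_leqP => w /andP[/lev_n]. Qed.

Lemma contract_partition_connected lev l n :
  partition_connected n (l ++ levels n lev) J ->
  partition_connected n (contract_edges l ++ levels n (contract_lev lev)) (c @: J).
Proof.
have compE (f : 'I_t -> 'I_t) (A : {set 'I_t}) : f @: (c @: A) = (f \o c) @: A.
  by rewrite (imset_comp f c).
move=> pc f; rewrite compE; apply: (leq_trans (pc (f \o c))).
rewrite !big_cat !big_map leq_add //; apply: leq_sum => A _ /=; last first.
  rewrite -compE (_ : c @: _ = [set v | (A < contract_lev lev v)%N] :&: c @: J) //.
  apply/setP => v'; rewrite in_setI in_set; apply/imsetP/andP => [[v]|].
    rewrite !inE => /andP[av Jv] ->; split; last exact: imset_f.
    by apply/contract_lev_gt; exists v.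
  by move=> [/contract_lev_gt[v [Jv <- av]] _]; exists v; rewrite // !inE av.
by rewrite -compE (setIidPl (imsetS c (subsetIr A J))).
Qed.

(** Messages that agree on [S] are constant on the fibres of [c], so they also solve the contracted
    system. *)
Lemma rigid_contract lev l p : rigid B S lev (zip l p) ->
  rigid B (c @: J) (contract_lev lev) (zip (contract_edges l) p) -> rigid B J lev (zip l p).
Proof.
move=> rigS rigc m [lm cm].
have rowS v w : v \in S -> w \in S -> row v m = row w m.
  apply: rigS; split=> [a v' w' Sv Sw|ez ezs v' w' /setIP[ev Sv] /setIP[ew Sw]].
    by apply: lm; exact: (subsetP SJ).
  by apply: (cm ez ezs); rewrite inE (ev, ew) (subsetP SJ).
have rowc v : row (c v) m = row v m by rewrite /c; case: ifP => // Sv; exact: rowS.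
have entc v a : m (c v) a = m v a by move/rowP/(_ a): (rowc v); rewrite !mxE.
have evc v (y : 'cV[K]_kap) : (m *m y) (c v) ord0 = (m *m y) v ord0.
  by rewrite !mxE; apply: eq_bigr => a _; rewrite entc.
have cmc : compatible B (c @: J) (contract_lev lev) (zip (contract_edges l) p) m.
  split=> [a v' w' _ _ /contract_lev_gt[v [Jv <- av]] /contract_lev_gt[w [Jw <- aw]]|].
    by rewrite !entc; exact: lm.
  move=> [e z] /mem_zip_map[A Az ->] v' w' /setIP[/imsetP[v vA ->] _] /setIP[/imsetP[w wA ->] _].
  by rewrite !evc; exact: (cm _ Az).
by move=> v w Jv Jw; rewrite -(rowc v) -(rowc w); apply: rigc => //; exact: imset_f.
Qed.

End Contraction.

Lemma rigid_top J lev s r v : J = [set r; v] -> (kap <= lev r)%N -> (kap <= lev v)%N ->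
  rigid B J lev s.
Proof.
move=> JE lr lv m [lm _]; have rv : row r m = row v m.
  apply/rowP => a; rewrite !mxE (lm a r v) ?JE ?set21 ?set22 //.
    exact: leq_trans (ltn_ord a) lr.
  exact: leq_trans (ltn_ord a) lv.
by move=> x y; rewrite JE => /set2P[] -> /set2P[] ->.
Qed.

Lemma rigid_small J lev s : (#|J| <= 1)%N -> rigid B J lev s.
Proof. by move=> J1 m _ v w Jv Jw; move/card_le1P: J1 => /(_ v Jv w); rewrite Jw inE => /esym/eqP->. Qed.

Lemma points_exist n : exists p, size p = n /\ forall z, z \in p -> X z.
Proof.
have [[x Xx] _] := Xprime; exists (nseq n x); rewrite size_nseq; split=> // z.
by rewrite mem_nseq => /andP[_ /eqP->].
Qed.

(** The count on all of [J]: [wl] and [wl2] are the weights of the level edges before and after the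
    degeneration, [s] is the sum of the levels before, [m2] the maximum after, and [a] the number of
    raised vertices. The lost edge weighs [a], which the levels regain. *)
Lemma raise_weight_ge w a wl wl2 m2 s : (m2 <= kap -> wl + kap = s -> wl2 + m2 = a + s ->
  w + (true + a).-1 + wl <= w + wl2)%N.
Proof. lia. Qed.

(** The count on a proper subset, where [b] tells whether it contains the root. Without the root the
    lost edge may weigh one less than [a], and the strict inequality absorbs the difference. *)
Lemma raise_weight_le w a (b : bool) wl wl2 m1 m2 s n :
  (m1 <= m2 -> wl + m1 = s -> wl2 + m2 = a + s ->
   w + (b + a).-1 + wl < n -> w + wl2 <= n)%N.
Proof. case: b; lia. Qed.

Lemma no_root_weight n w wl m s : (1 < n -> kap * n <= w + s -> m <= kap -> wl + m = s ->
  w + wl < kap * n.-1 -> False)%N.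
Proof. by case: n => // n _; rewrite mulnS /=; lia. Qed.

Definition raise lev r v := if v == r then kap else lev v.

(** A level edge above the former maximum contains only [r] within [J] and weighs 0, so giving full
    level to a root of maximal level changes no weight. *)
Lemma weight_raise J lev r S : r \in J -> {in J, forall v, lev v <= lev r}%N ->
  S \subset J -> weight (levels kap (raise lev r)) S = weight (levels kap lev) S.
Proof.
move=> Jr max_r SJ; rewrite /weight !big_map; apply: eq_big_seq => a.
rewrite mem_iota add0n => /andP[_ lt_a].
have [Sr|Sr] := boolP (r \in S); last first.
  congr (#|pred_of_set _|.-1); apply/setP => v; rewrite !inE /raise.
  by case: (v =P r) => // ->; rewrite (negPf Sr) !andbF.
have [lt_ar|le_ra] := ltnP a (lev r).
  congr (#|pred_of_set _|.-1); apply/setP => v; rewrite !inE /raise.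
  by case: (v =P r) => // ->; rewrite lt_a lt_ar.
rewrite (_ : [set v | (a < raise lev r v)%N] :&: S = [set r]).
  rewrite (_ : [set v | (a < lev v)%N] :&: S = set0) ?cards1 ?cards0 //.
  apply/setP => v; rewrite !inE; apply/negP => /andP[av /(subsetP SJ)/max_r vr].
  by move: (leq_trans av (leq_trans vr le_ra)); rewrite ltnn.
apply/setP => v; rewrite !inE /raise; case: (v =P r) => [->|_]; first by rewrite lt_a Sr.
apply/negP => /andP[av /(subsetP SJ)/max_r vr].
by move: (leq_trans av (leq_trans vr le_ra)); rewrite ltnn.
Qed.

Lemma rigid_raise J lev r s : r \in J -> {in J, forall v, lev v <= lev r}%N ->
  rigid B J (raise lev r) s -> rigid B J lev s.
Proof.
move=> Jr max_r rig m [lm cm]; apply: rig; split=> // a v w Jv Jw; rewrite /raise.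
case: (v =P r) => [->|_]; case: (w =P r) => [->|_] // av aw.
- by apply: lm => //; exact: leq_trans aw (max_r _ Jw).
- by apply: lm => //; exact: leq_trans av (max_r _ Jv).
- exact: lm.
Qed.

Theorem generic_rigid J lev l : {in J, forall v, lev v <= kap}%N ->
  partition_connected kap (l ++ levels kap lev) J ->
  exists p, [/\ size p = size l, forall z, z \in p -> X z & rigid B J lev (zip l p)].
Proof.
have [N] := ubnP (#|J| + size l)%N; elim: N => // N IHN in J lev l * => ltN lev_k pc.
have trivial_rigid : (forall s, rigid B J lev s) ->
    exists p, [/\ size p = size l, forall z, z \in p -> X z & rigid B J lev (zip l p)].
  by move=> rig; have [p [szp Xp]] := points_exist (size l); exists p.
have [J1|J2] := leqP #|J| 1; first by apply: trivial_rigid => s; exact: rigid_small.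
have t0 : (0 < t)%N by have /card_gt1P[[x ltx] _] := J2; exact: leq_ltn_trans ltx.
set fam := l ++ levels kap lev in pc.
pose tight S := [&& S \proper J, 1 < #|S| & kap * #|S|.-1 <= weight fam S]%N.
have [/existsP[S0 tS0]|/existsPn no_tight] := boolP [exists S, tight S].
  (* The proper subsets of a smallest tight set are not tight, so [partition_connected_of_weight]
     applies to it. *)
  case: (arg_minnP (fun S : {set 'I_t} => #|S|) tS0) => S /and3P[pSJ S2 wS] minS.
  have SJ := proper_sub pSJ.
  have [|||p1 [sz1 X1 rig1]] := IHN S lev l.
  - by rewrite -ltnS; apply: leq_trans ltN; rewrite ltnS ltn_add2r proper_card.
  - by move=> v /(subsetP SJ); exact: lev_k.
  - apply: partition_connected_of_weight => // S' pS' S'2; rewrite leqNgt; apply/negP => /ltnW wS'.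
    have /minS : tight S' by rewrite /tight S'2 wS' (proper_trans pS').
    by rewrite leqNgt proper_card.
  have /card_gt0P[v0 Sv0] : (0 < #|S|)%N by exact: ltnW.
  have [|||p2 [sz2 X2 rig2]] := IHN ((fun v => if v \in S then v0 else v) @: J)
      (contract_lev J S v0 lev) (contract_edges J S v0 l).
  - by rewrite size_map -ltnS; apply: leq_trans ltN; rewrite ltnS ltn_add2r contract_card.
  - exact: contract_lev_le.
  - exact: contract_partition_connected.
  rewrite size_map in sz2.
  (* Both subsystems have to be rigid at the same points; each is an open condition in every single
     point. *)
  pose Q1 (p : seq 'cV[K]_k) := size p = size l /\ rigid B S lev (zip l p).
  pose Q2 (p : seq 'cV[K]_k) := size p = size l /\
    rigid B ((fun v => if v \in S then v0 else v) @: J)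
      (contract_lev J S v0 lev) (zip (contract_edges J S v0 l) p).
  have [||||||||p [szp Xp [_ r1] [_ r2]]] := @common_points K k X Q1 Q2 p1 p2 => //.
  - move=> p z0 p' [szp rig]; have [f [f0 rigf]] := rigid_zip_open t0 szp rig.
    exists f; split=> // z /rigf rigz; split=> //.
    by move: szp; rewrite !size_cat.
  - move=> p z0 p' [szp rig].
    have [|f [f0 rigf]] := rigid_zip_open t0 _ rig; first by rewrite size_map.
    exists f; split=> // z /rigf rigz; split=> //.
    by move: szp; rewrite !size_cat.
  - by rewrite sz1.
  - by exists p; split=> //; [rewrite szp | exact: rigid_contract r2].
have w_lt S : S \proper J -> (1 < #|S| -> weight fam S < kap * #|S|.-1)%N.
  by move=> pS S2; rewrite ltnNge; apply: contra (no_tight S) => wS; rewrite /tight pS S2.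
have wJ : (kap * #|J|.-1 <= weight fam J)%N.
  by have := pc id; rewrite imset_id; under eq_bigr => A _ do rewrite imset_id.
have /card_gt0P[r0 Jr0] := ltnW J2.
have [r Jr max_r] : exists2 r, r \in J & {in J, forall v, lev v <= lev r}%N.
  by case: (@arg_maxnP _ r0 (mem J) lev Jr0) => r; exists r.
have lev1_le : {in J, forall v, raise lev r v <= kap}%N.
  by move=> v /lev_k; rewrite /raise; case: (v == r).
have w_levels S : S \subset J ->
    (weight (levels kap lev) S + \max_(v in S) raise lev r v = \sum_(v in S) raise lev r v)%N.
  move=> SJ; rewrite -(weight_raise Jr max_r SJ) weight_levels // => v /(subsetP SJ).
  exact: lev1_le.
have max_le S : S \subset J -> (\max_(v in S) raise lev r v <= kap)%N.
  by move=> SJ; apply/bigmax_leqP => v /(subsetP SJ)/lev1_le.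
have max_r1 S : r \in S -> S \subset J -> (\max_(v in S) raise lev r v = kap)%N.
  move=> Sr SJ; apply/eqP; rewrite eqn_leq max_le //.
  by apply: leq_trans (leq_bigmax_cond _ Sr); rewrite /raise eqxx.
(* The level edges alone give [r] and a second vertex of full level the weight [kap] of a tight
   pair. Hence the pair is all of [J], and its messages are tied in every coordinate. *)
have pair_case v : v \in J -> v != r -> (kap <= lev v)%N ->
    exists p, [/\ size p = size l, forall z, z \in p -> X z & rigid B J lev (zip l p)].
  move=> Jv vr kv; have SJ : [set r; v] \subset J by rewrite subUset !sub1set Jr Jv.
  have [JE|nJE] := eqVneq [set r; v] J.
    by apply: trivial_rigid => s; apply: (rigid_top (esym JE)) => //; exact: leq_trans kv (max_r _ Jv).
  have c2 : #|[set r; v]| = 2 by rewrite cards2 eq_sym vr.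
  have := w_lt [set r; v]; rewrite properEneq nJE SJ c2 => /(_ isT isT).
  rewrite weight_cat muln1 ltnNge => /negP[]; apply: leq_trans (leq_addl _ _).
  have := w_levels _ SJ; rewrite (max_r1 _ _ SJ) ?set21 //.
  rewrite big_setU1 ?inE 1?eq_sym //= big_set1 /raise eqxx (negPf vr) => E.
  by rewrite -(leq_add2r kap) E leq_add2l.
have [/hasP[e le /andP[re e2]]|/hasPn no_e] :=
    boolP (has (fun e : {set 'I_t} => (r \in e) && (1 < #|e :&: J|)%N) l).
  set A := (e :&: J) :\ r.
  have [/existsP[v /andP[vA kv]]|/existsPn low] := boolP [exists v, (v \in A) && (kap <= lev v)%N].
    by move: vA => /setD1P[vr /setIP[_ Jv]]; exact: (pair_case v).
  have lowA v : v \in A -> (raise lev r v < kap)%N.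
    move=> vA; have := low v; rewrite vA /= -ltnNge /raise => lt_v.
    by move: vA => /setD1P[/negPf-> _].
  have reJ : r \in e :&: J by rewrite inE re.
  have [l1 [l2 lE]] : exists l1 l2, l = l1 ++ e :: l2.
    by case/splitPr: le => l1 l2; exists l1, l2.
  pose lev2 v := ((v \in A) + raise lev r v)%N.
  have lev2_le : {in J, forall v, lev2 v <= kap}%N.
    move=> v Jv; rewrite /lev2; have [/lowA//|_] := boolP (v \in A); exact: lev1_le.
  have w2 S : S \subset J ->
      (weight (levels kap lev2) S + \max_(v in S) lev2 v =
       #|A :&: S| + \sum_(v in S) raise lev r v)%N.
    move=> SJ; rewrite weight_levels => [|v /(subsetP SJ)]; last exact: lev2_le.
    rewrite big_split /=; congr (_ + _)%N; rewrite -sum1_card big_mkcond [RHS]big_mkcond.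
    by apply: eq_bigr => v _; rewrite in_setI; case: (v \in S); case: (v \in A).
  have max2_le S : S \subset J -> (\max_(v in S) lev2 v <= kap)%N.
    by move=> SJ; apply/bigmax_leqP => v /(subsetP SJ)/lev2_le.
  have max2_ge S : (\max_(v in S) raise lev r v <= \max_(v in S) lev2 v)%N.
    by apply/bigmax_leqP => v Sv; apply: leq_trans (leq_bigmax_cond _ Sv); exact: leq_addl.
  have famE S : weight fam S =
      (weight (l1 ++ l2) S + #|e :&: S|.-1 + weight (levels kap lev) S)%N.
    by rewrite /fam lE !weight_cat weight_cons addnCA -!addnA addnCA; congr (_ + _)%N; rewrite addnCA.
  have cardA S : S \subset J -> #|e :&: S| = ((r \in S) + #|A :&: S|)%N.
    move=> SJ; rewrite (cardsD1 r) !inE re /=; congr (_ + #|pred_of_set _|).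
    apply/setP => v; rewrite !inE; case: (v =P r) => //= _; case: (v \in e) => //=.
    by case: (boolP (v \in S)) => [/(subsetP SJ)->|_]; rewrite ?andbF.
  (* The edge [e] is dropped, and each of its other vertices in [J] gains one level. *)
  have [|||p [szp Xp rigp]] := IHN J lev2 (l1 ++ l2).
  - by move: ltN; rewrite lE !size_cat /=; lia.
  - exact: lev2_le.
  - apply: partition_connected_of_weight => [|S pS S2].
      apply: leq_trans wJ _; rewrite famE !weight_cat.
      have := w2 J (subxx J); have := w_levels J (subxx J).
      have := max2_le J (subxx J); rewrite (max_r1 J Jr (subxx J)) (cardA J (subxx J)) Jr.
      exact: raise_weight_ge.
    have SJ := proper_sub pS; have := w_lt S pS S2; rewrite famE !weight_cat.
    have := w2 S SJ; have := w_levels S SJ; have := max2_ge S; rewrite (cardA S SJ).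
    exact: raise_weight_le.
  have lev1_r : (kap <= raise lev r r)%N by rewrite /raise eqxx.
  have [z [Xz rigz]] := rigid_degeneration Xprime PG Bflag reJ lev1_r lowA rigp.
  have szt : size (take (size l1) p) = size l1.
    by rewrite size_takel // szp size_cat leq_addr.
  exists (take (size l1) p ++ z :: drop (size l1) p); split.
  - by rewrite lE !size_cat /= szt size_drop szp size_cat addKn.
  - move=> y; rewrite mem_cat inE orbCA -mem_cat cat_take_drop => /predU1P[->//|]; exact: Xp.
  - apply: (rigid_raise Jr max_r); apply: rigid_sub rigz => y.
    rewrite lE -{1}(cat_take_drop (size l1) p) !zip_cat //= !mem_cat !inE mem_cat.
    by rewrite orbCA.
(* No edge of [l] joins [r] to another vertex of [J], so [l] puts all its weight on [J :\ r]. If two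
   vertices remain there, this set is tight; if only one remains, the weight of [J] forces it to
   have full level. *)
have vE : r |: (J :\ r) = J by exact: setD1K.
have SJ : J :\ r \subset J by exact: subD1set.
have cJ : #|J| = #|J :\ r|.+1 by rewrite (cardsD1 r) Jr.
have wl : weight l J = weight l (J :\ r).
  rewrite /weight; apply: eq_big_seq => e le; have := no_e e le.
  have [re /=|re _] := boolP (r \in e); last first.
    congr (#|pred_of_set _|.-1); apply/setP => v; rewrite !inE.
    by case: (v =P r) => //= ->; rewrite (negPf re).
  rewrite -leqNgt => e1; have := subset_leq_card (setIS e SJ).
  by case: #|e :&: J| e1 => [|[]] // _; case: #|_| => [|[]].
have wJl : (weight (levels kap lev) J = \sum_(v in J :\ r) raise lev r v)%N.
  have := w_levels J (subxx J); rewrite (max_r1 J Jr (subxx J)) (big_setD1 r) //=.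
  by rewrite (_ : raise lev r r = kap) ?/raise ?eqxx // addnC => /addnI.
have [S2|S1] := ltnP 1 #|J :\ r|.
  have := w_lt _ (properD1 Jr) S2; have := w_levels _ SJ; have := max_le _ SJ.
  move: wJ; rewrite /fam !weight_cat wl wJl cJ /=.
  by move=> wJ max_S wS wlt; case: (no_root_weight S2 wJ max_S wS wlt).
have /cards1P[v Sv] : #|J :\ r| == 1%N.
  by rewrite eqn_leq S1 -ltnS -cJ.
have /setD1P[vr Jv] : v \in J :\ r by rewrite Sv set11.
apply: (pair_case v) => //; move: wJ; rewrite /fam weight_cat wl wJl cJ Sv cards1 muln1.
rewrite big_set1 /raise (negPf vr) /weight big1 // => e _.
have := subset_leq_card (subsetIr e [set v]); rewrite cards1.
by case: #|_| => [|[]].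
Qed.

End GenericRigidity.

(** * Faulty columns *)

Local Notation lev0 := (fun=> 0%N).

Lemma generic_rigid_mds (K : closedFieldType) k kap t (X : 'cV[K]_k -> Prop)
    (B : 'M[K]_(kap, k)) (J : {set 'I_t}) l :
  prime_locus X -> MDS_variety X -> row_free B -> partition_connected kap l J ->
  exists p, [/\ size p = size l, forall z, z \in p -> X z & rigid B J lev0 (zip l p)].
Proof.
move=> Xprime Xmds Bfree pc.
have [M [G [uM PG flag]]] := place_flag Xprime Bfree Xmds.
have [//||p [szp Xp rig]] := @generic_rigid K k kap t X G (M *m B) Xprime PG flag J lev0 l.
  by move=> f; apply: (leq_trans (pc f)); rewrite big_cat leq_addr.
exists p; split=> // m [_ cm] v w Jv Jw.
have mM (y : 'cV_k) : m *m invmx M *m (M *m B *m y) = m *m (B *m y).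
  by rewrite !mulmxA mulmxKV.
have := rig (m *m invmx M) _ v w Jv Jw; rewrite !row_mul => /(_ _)/(can_inj (mulmxK _))->//.
  by rewrite unitmx_inv.
by split=> // ez ezp v' w' ev ew; rewrite !mM; exact: cm.
Qed.

Lemma card_sets_ord t : #|{: {set 'I_t}}| = (2 ^ t)%N.
Proof. by rewrite -cardsT -powersetT card_powerset cardsT card_ord. Qed.

Section Certificates.
Variables (K : closedFieldType) (k kap t n : nat) (X : 'cV[K]_k -> Prop).
Variables (B : 'M[K]_(kap, k)) (E : 'I_n -> {set 'I_t}) (J : {set 'I_t}).
Implicit Types (x : 'I_n -> 'cV[K]_k) (A R I : {set 'I_n}) (l : seq {set 'I_t}).
Implicit Types (s : seq ({set 'I_t} * 'cV[K]_k)).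

(** Since rigidity is open, one choice of points of [X] for the pending edges [l] stands for the
    generic choice; [s] holds the points already revealed. *)
Definition generically_rigid s l := exists s',
  [/\ perm_eq (unzip1 s') l, forall q, q \in s' -> X q.2 & rigid B J lev0 (s ++ s')].

Lemma generically_rigid_open s e l : (0 < t)%N -> e \in l -> generically_rigid s l ->
  exists f : {mpoly K[k]}, [/\ (msize f <= t)%N, exists z, X z /\ ev f z != 0 &
    forall z, ev f z != 0 -> generically_rigid ((e, z) :: s) (rem e l)].
Proof.
move=> t0 el [s' [pl Xs rig]].
have /mapP[[e' z0] ezs /= eE] : e \in unzip1 s' by rewrite (perm_mem pl).
rewrite -{e'}eE in ezs; have ps' := perm_to_rem ezs; set s1 := rem _ s' in ps'.
have prem : perm_eq (unzip1 s1) (rem e l).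
  rewrite -(perm_cons e); apply: (perm_trans _ (perm_to_rem el)).
  by apply: (perm_trans _ pl); rewrite perm_sym; exact: (perm_map fst ps').
have [|f [szf f0 rigf]] := @rigid_open _ _ _ _ B J lev0 (s ++ s1) e z0 t0.
  by apply: rigid_sub rig => y; rewrite mem_cat (perm_mem ps') !inE mem_cat orbCA.
exists f; split=> //; first by exists z0; split=> //; exact: (Xs (e, z0)).
move=> z fz; exists s1; split=> // [q qs|]; last exact: rigf.
by apply: Xs; rewrite (perm_mem ps') inE qs orbT.
Qed.

(* [A] is a set of discarded columns.  Edges are given as a multiset [l] of generic
   edges from which the run takes one out as soon as a column of that type shows up;
   the columns of the guess [R] are skipped, and [b] of each type are kept in reserve. *)
Definition reserve b A := flatten [seq
  nseq (#|[set j : 'I_n | (j \notin A) && (E j == e)]| - b) e | e <- enum {: {set 'I_t}}].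

Fixpoint run b x A R i : seq ({set 'I_t} * 'cV[K]_k) * seq {set 'I_t} :=
  if i is i'.+1 then
    let: (s, l) := run b x A R i' in
    if insub i' is Some j then
      if [&& j \notin A, j \notin R & E j \in l] then ((E j, x j) :: s, rem (E j) l)
      else (s, l)
    else (s, l)
  else ([::], reserve b A).

(** The point at [i] is the separate argument [z], while [x] and [R] are read only below [i]: this
    lets the faulty values be counted once the earlier columns are fixed. *)
Definition fault_at b x A R (i : 'I_n) z :=
  let: (s, l) := run b x A R i in
  [/\ i \notin A, E i \in l, generically_rigid s l &
      ~ generically_rigid ((E i, z) :: s) (rem (E i) l)].

Lemma eq_run b x x' A R R' i : (forall j : 'I_n, (j < i)%N -> x j = x' j) ->
  (forall j : 'I_n, (j < i)%N -> (j \in R) = (j \in R')) ->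
  run b x A R i = run b x' A R' i.
Proof.
elim: i => //= i IHi eqx eqR; rewrite IHi => [||j ji]; last 2 first.
- by move=> j ji; apply: eqx; exact: leqW.
- by apply: eqR; exact: leqW.
case: (run _ _ _ _ _) => s l; case: insubP => //= j _ ji.
by rewrite eqx ?eqR ?ji.
Qed.

Lemma eq_fault_at b x x' A R R' (i : 'I_n) z : (forall j : 'I_n, (j < i)%N -> x j = x' j) ->
  (forall j : 'I_n, (j < i)%N -> (j \in R) = (j \in R')) ->
  fault_at b x A R i z -> fault_at b x' A R' i z.
Proof. by move=> eqx eqR; rewrite /fault_at (eq_run b A eqx eqR). Qed.

Lemma count_reserve b A e :
  count_mem e (reserve b A) = (#|[set j : 'I_n | (j \notin A) && (E j == e)]| - b)%N.
Proof.
rewrite count_flatten -map_comp sumnE big_map big_enum /= (bigD1 e) //= count_nseq /= eqxx mul1n.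
by rewrite big1 ?addn0 // => e' /negPf ne; rewrite count_nseq /= ne mul0n.
Qed.

Section Run.
Variables (b : nat) (x : 'I_n -> 'cV[K]_k) (A : {set 'I_n}).
Hypothesis rig0 : generically_rigid [::] (reserve b A).

Let used R i e := [set j : 'I_n | [&& (j < i)%N, j \notin A, j \notin R & E j == e]].

(** The guess [R] is built along the run: a column enters it when taking its point would destroy
    generic rigidity. The count says that, until a type is exhausted, it has lost one pending copy
    for each column used. *)
Lemma run_invariant i : (i <= n)%N -> exists R,
  [/\ forall j, j \in R -> (j < i)%N /\ fault_at b x A R j (x j),
      generically_rigid (run b x A R i).1 (run b x A R i).2,
      forall q, q \in (run b x A R i).1 -> exists j, q = (E j, x j) &
      forall e, count_mem e (run b x A R i).2 = 0%N \/
        count_mem e (reserve b A) = (count_mem e (run b x A R i).2 + #|used R i e|)%N].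
Proof.
elim: i => [_|i IHi lt_in].
  exists set0; split=> // [j|e]; first by rewrite inE.
  by right; rewrite (_ : used _ _ _ = set0) ?cards0 ?addn0 //; apply/setP => j; rewrite !inE.
have [R [faultR rigR sR cR]] := IHi (ltnW lt_in).
pose j := Ordinal lt_in; have insubi : insub i = Some j by rewrite insubT.
have jR : j \notin R by apply/negP => /faultR[]; rewrite ltnn.
case st: (run b x A R i) rigR sR cR => [s l] /= rigR sR cR.
have usedS e R' : R' \subset j |: R -> R \subset R' ->
    used R' i.+1 e = if [&& j \notin A, j \notin R' & E j == e] then j |: used R i e else used R i e.
  move=> R'jR RR'; apply/setP => j'; rewrite inE ltnS leq_eqVlt.
  have [j'i|j'i] := eqVneq (nat_of_ord j') i.
    have -> : j' = j by exact: val_inj.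
    by rewrite /=; case: ifP; rewrite !inE ?eqxx ?ltnn.
  have nj' : j' != j by apply: contraNneq j'i => ->.
  have R'R : (j' \in R') = (j' \in R).
    by apply/idP/idP => [/(subsetP R'jR)|/(subsetP RR')//]; rewrite !inE (negPf nj').
  by rewrite /= R'R; case: ifP; rewrite !inE ?(negPf nj').
have jused e R' : j \notin used R' i e by rewrite inE ltnn.
have [act|skip] := boolP ((j \notin A) && (E j \in l)); last first.
  exists R; rewrite /= insubi st jR; rewrite andTb (negPf skip); split=> //.
    by move=> j' /faultR[ji' ?]; split=> //; exact: leqW.
  move=> e; have [|cE] := cR e; first by left.
  rewrite (usedS e R (subsetUr _ _) (subxx _)) jR /=; case: ifP => [/andP[jA /eqP Ej]|_]; last by right.
  by left; apply/count_memPn; rewrite -Ej; move: skip; rewrite jA.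
have /andP[jA Ejl] := act.
have [rig1|nrig1] := classic (generically_rigid ((E j, x j) :: s) (rem (E j) l)).
  exists R; rewrite /= insubi st jA jR Ejl; split=> //.
  - by move=> j' /faultR[ji' ?]; split=> //; exact: leqW.
  - by move=> q; rewrite inE => /predU1P[->|/sR//]; exists j.
  move=> e; rewrite (usedS e R (subsetUr _ _) (subxx _)) jR jA /=.
  have := cR e; rewrite (seq.permP (perm_to_rem Ejl)) /=.
  case: (E j =P e) => [<-|_]; last by rewrite add0n.
  by rewrite add1n cardsU1 jused add1n addnS addSn => -[//|->]; right.
have Rlt j' : j' \in R -> (j' < i)%N by case/faultR.
have eqR (i' : nat) : (i' <= i)%N -> run b x A (j |: R) i' = run b x A R i'.
  move=> le_i; apply: eq_run => // j' lt_j'; rewrite !inE.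
  suff -> : (j' == j) = false by [].
  by apply/negP => /eqP j'j; move: (leq_trans lt_j' le_i); rewrite j'j ltnn.
exists (j |: R); rewrite /= insubi eqR // st setU11 andbF; split=> //.
  move=> j'; rewrite !inE => /predU1P[->|j'R].
    by split=> //; rewrite /fault_at eqR // st.
  have [j'i fj'] := faultR _ j'R; split; first exact: leqW.
  by move: fj'; rewrite /fault_at eqR // ltnW.
move=> e; rewrite (usedS e _ (subxx _) (subsetUr _ _)) setU11 andbF /=.
exact: cR.
Qed.

Lemma run_faults : ~ rigid B J lev0 [seq (E j, x j) | j <- enum 'I_n] ->
  exists R, (forall j, j \in R -> fault_at b x A R j (x j)) /\ (b < #|R|)%N.
Proof.
move=> nrig; have [R [faultR rigR sR cR]] := run_invariant (leqnn n).
exists R; split=> [j /faultR[] //|].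
case st: (run b x A R n) rigR sR cR => [s l] /= rigR sR cR.
case: l => [|e l] in st rigR cR.
  case: nrig; have [s' [ps _ rig]] := rigR.
  have s0 : s' = [::].
    by apply/eqP; rewrite -size_eq0 -(size_map fst) (perm_size ps).
  rewrite s0 cats0 in rig; apply: rigid_sub rig => q /sR[j ->].
  by apply: map_f; rewrite mem_enum.
have arith N U r c : (N <= U + r -> N - b = (1 + c) + U -> b < r)%N by lia.
have [|] := cR e; first by rewrite /= eqxx.
rewrite count_reserve /= eqxx.
have : (#|[set j : 'I_n | (j \notin A) && (E j == e)]| <= #|used R n e| + #|R|)%N.
  apply: leq_trans (leq_card_setU _ _); apply/subset_leq_card/subsetP => j.
  by rewrite !inE ltn_ord => /andP[-> ->]; rewrite andbT orbC; case: (j \in R).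
exact: arith.
Qed.

End Run.

(** For a partition into p parts, each column discarded or held in reserve costs at most p - 1
    crossings. There are at most [q] such columns: those of [A], and up to [b] for each of the
    [2 ^ t] types. *)
Lemma reserve_rigid q b A : prime_locus X -> MDS_variety X -> row_free B ->
  partition_connected (kap + q) [seq E j | j <- enum 'I_n] J ->
  (#|A| + 2 ^ t * b <= q)%N -> generically_rigid [::] (reserve b A).
Proof.
move=> Xprime Xmds Bfree pc le_q.
suff pcr : partition_connected kap (reserve b A) J.
  have [p [szp Xp rig]] := generic_rigid_mds Xprime Xmds Bfree pcr.
  exists (zip (reserve b A) p); split=> //; first by rewrite unzip1_zip ?szp.
  move=> [e z] /(map_f snd) /=; rewrite -/unzip2 unzip2_zip ?szp //; exact: Xp.
move=> f; set M := #|f @: J|.-1; pose W (e : {set 'I_t}) := #|f @: (e :&: J)|.-1.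
have WM e : (W e <= M)%N.
  have : (#|f @: (e :&: J)| <= #|f @: J|)%N by rewrite subset_leq_card // imsetS // subsetIr.
  by rewrite /W /M; case: #|_| => [|c]; case: #|_|.
pose N e := #|[set j : 'I_n | (j \notin A) && (E j == e)]|.
have -> : (\sum_(e <- reserve b A) #|f @: (e :&: J)|.-1 = \sum_e (N e - b) * W e)%N.
  rewrite big_flatten big_map big_enum; apply: eq_bigr => e _.
  by rewrite -/(N e); elim: (N e - b)%N => [|c IHc]; rewrite ?big_nil //= big_cons IHc mulSn.
have EA : (\sum_(j | j \notin A) W (E j) = \sum_e N e * W e)%N.
  rewrite (partition_big E predT) //=; apply: eq_bigr => e _.
  rewrite (eq_bigr (fun=> W e)) => [|j /andP[_ /eqP->] //].
  by rewrite sum_nat_const /N; congr (_ * _)%N; apply: eq_card => j; rewrite !inE.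
have := pc f; rewrite big_map big_enum /= -/M (bigID (mem A)) /= EA => pcf.
have inA : (\sum_(j in A) W (E j) <= #|A| * M)%N.
  by rewrite -sum_nat_const; apply: leq_sum.
have split_b : (\sum_e N e * W e <= \sum_e (N e - b) * W e + 2 ^ t * b * M)%N.
  have <- : (\sum_(e : {set 'I_t}) b * M = 2 ^ t * b * M)%N.
    by rewrite sum_nat_const card_sets_ord mulnA.
  rewrite -big_split; apply: leq_sum => e _ /=.
  have := leq_mul (leqnn b) (WM e); nia.
have : ((#|A| + 2 ^ t * b) * M <= q * M)%N by rewrite leq_mul2r le_q orbT.
move: pcf inA split_b; rewrite !mulnDl.
move: (\sum_(j in A) _)%N (\sum_e _)%N (\sum_e _)%N (#|A| * M)%N (2 ^ t * b * M)%N => *; lia.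
Qed.

Lemma fault_at_notin b x A R i z : fault_at b x A R i z -> i \notin A.
Proof. by rewrite /fault_at; case: (run _ _ _ _ _) => s l []. Qed.

(** Whether a column is faulty depends on [R] only below it, so the last column can be removed from
    [R] without affecting the others. *)
Lemma faults_shrink b x A R q : (forall j, j \in R -> fault_at b x A R j (x j)) ->
  (q <= #|R|)%N ->
  exists R', (forall j, j \in R' -> fault_at b x A R' j (x j)) /\ #|R'| = q.
Proof.
have [N] := ubnP #|R|; elim: N => // N IHN in R * => ltN fR.
rewrite leq_eqVlt => /predU1P[->|ltq]; first by exists R.
have /card_gt0P[j0 Rj0] : (0 < #|R|)%N by exact: leq_ltn_trans ltq.
have [j Rj max_j] : exists2 j, j \in R & forall i, i \in R -> (i <= j)%N.
  by case: (@arg_maxnP _ j0 (mem R) (@nat_of_ord n) Rj0) => j; exists j.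
have cR : #|R| = #|R :\ j|.+1 by rewrite (cardsD1 j) Rj.
apply: (IHN (R :\ j)) => [|i /setD1P[ij Ri]|]; rewrite ?cR // in ltN ltq *.
apply: eq_fault_at (fR i Ri) => // j' lt_j'; rewrite !inE.
by case: (j' =P j) => // j'j; move: (leq_trans lt_j' (max_j i Ri)); rewrite j'j ltnn.
Qed.

(** [lab] numbers the passes: in the pass of [i], the columns of earlier passes are discarded and
    those of the same pass form the guess. Thus [I] and [lab] suffice to replay the runs as the
    columns are revealed. *)
Definition certificate b x I (lab : 'I_n -> nat) := forall i, i \in I ->
  fault_at b x [set j in I | (lab j < lab i)%N] [set j in I | lab j == lab i] i (x i).

(** As long as fewer than [c] columns are discarded, a further pass finds more than [b] new faulty
    columns, of which no more are kept than are still missing to [c]. *)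
Lemma certificate_exists b c x u : (0 < t)%N ->
  (forall A, #|A| < c -> generically_rigid [::] (reserve b A))%N ->
  ~ rigid B J lev0 [seq (E j, x j) | j <- enum 'I_n] ->
  exists I lab, [/\ (#|I| <= c)%N, (minn c (u * b.+1) <= #|I|)%N,
    (forall i, i \in I -> lab i < u)%N & certificate b x I lab].
Proof.
move=> t0 rig0 nrig; elim: u => [|u [I [lab [leI geI labu cert]]]].
  exists set0, (fun=> 0%N); split=> [|||i]; rewrite ?cards0 ?mul0n ?minn0 //.
    by move=> i; rewrite inE.
  by rewrite inE.
move: leI; rewrite leq_eqVlt => /predU1P[cI|ltI].
  exists I, lab; split=> [|||//]; rewrite ?cI ?geq_minl //.
  by move=> i /labu; exact: ltnW.
have [R0 [fR0 bR0]] := run_faults (rig0 I ltI) nrig.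
have [R [fR cR]] := faults_shrink fR0 (geq_minr (c - #|I|) #|R0|).
have RI i : i \in R -> i \notin I by move/fR/fault_at_notin.
pose lab' i := if i \in I then lab i else u.
have dIR : I :&: R = set0 by apply/setP => i; rewrite !inE; apply/negP => /andP[Ii /RI]; rewrite Ii.
have cIR : #|I :|: R| = (#|I| + #|R|)%N by rewrite cardsU dIR cards0 subn0.
exists (I :|: R), lab'; split.
- by rewrite cIR cR; have := geq_minl (c - #|I|) #|R0|; lia.
- rewrite cIR cR; move: geI; rewrite mulSn.
  case: (ltnP (c - #|I|) #|R0|) => _; move: (u * b.+1)%N => v; lia.
- by move=> i; rewrite /lab'; case: ifP => [/labu/ltnW|].
move=> i; rewrite in_setU; have [Ii _|nIi /= Ri] := boolP (i \in I).
  have lab'i : lab' i = lab i by rewrite /lab' Ii.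
  have := cert i Ii; congr fault_at; apply/setP => j; rewrite !inE lab'i /lab'.
    by case: (boolP (j \in I)) => //= _; have := labu i Ii; case: ltngtP; rewrite ?andbF.
  case: (boolP (j \in I)) => //= _; have := labu i Ii; case: ltngtP; rewrite ?andbF //.
have lab'i : lab' i = u by rewrite /lab' (negPf nIi).
have := fR i Ri; congr fault_at; apply/setP => j; rewrite !inE lab'i /lab'.
  case: (boolP (j \in I)) => [Ij|_]; first by rewrite labu.
  by rewrite ltnn andbF.
case: (boolP (j \in I)) => [Ij|_]; last by rewrite eqxx andbT.
rewrite (ltn_eqF (labu _ Ij)); apply/negP => /RI; by rewrite Ij.
Qed.

End Certificates.

(** * Counting *)

Lemma asbP (P : Prop) : reflect P (asb P).
Proof. by rewrite /asb; case: excluded_middle_informative => p; constructor. Qed.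

Section Counting.
Local Open Scope nat_scope.

Lemma union_bound (T C : finType) (bad : {set T}) (P : pred C) (D : C -> {set T}) :
  (forall f, f \in bad -> exists2 c, P c & f \in D c) -> #|bad| <= \sum_(c | P c) #|D c|.
Proof.
move=> cover; rewrite -sum1_card.
under [X in _ <= X]eq_bigr => c _ do rewrite -sum1_card big_mkcond.
rewrite exchange_big [X in X <= _]big_mkcond; apply: leq_sum => f _.
case: ifP => // /cover[c Pc fDc]; rewrite (bigD1 c) //= fDc; exact: leq_addr.
Qed.

Variables (T : finType) (n : nat).
Implicit Types (f g : {ffun 'I_n -> T}).

Lemma card_sequential (W : 'I_n -> {ffun 'I_n -> T} -> {set T}) (w : 'I_n -> nat) :
  (forall (i : 'I_n) f g, (forall j : 'I_n, j < i -> f j = g j) -> W i f = W i g) ->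
  (forall (i : 'I_n) f, (forall j : 'I_n, j < i -> f j \in W j f) -> #|W i f| <= w i) ->
  #|[set f : {ffun 'I_n -> T} | [forall i, f i \in W i f]]| <= \prod_i w i.
Proof.
move=> Wpast Wcard; set V := [set _ | _].
have [->|[f0 _]] := set_0Vmem V; first by rewrite cards0.
(* Coordinates from [m] on are frozen at those of [f0]; unfreezing coordinate [m] multiplies the
   count by at most [w m]. *)
pose V' m := [set f : {ffun 'I_n -> T} |
  [forall i : 'I_n, if i < m then f i \in W i f else f i == f0 i]].
suff V'card m : m <= n -> #|V' m| <= \prod_(i < n | i < m) w i.
  have := V'card n (leqnn n).
  have -> : \prod_(i < n | i < n) w i = \prod_i w i.
    by apply: eq_bigl => i; rewrite ltn_ord.
  apply: leq_trans; apply: subset_leq_card; apply/subsetP => f.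
  by rewrite !inE => /forallP Vf; apply/forallP => i; rewrite ltn_ord.
elim: m => [_|m IHm ltm].
  rewrite big_pred0 // -(cards1 f0); apply: subset_leq_card; apply/subsetP => f.
  by rewrite !inE => /forallP Vf; apply/eqP/ffunP => i; exact/eqP/(Vf i).
pose im := Ordinal ltm; pose cut f := [ffun i => if i == im then f0 im else f i] : {ffun 'I_n -> T}.
have cutlt f (j : 'I_n) : j < m -> cut f j = f j.
  by move=> jm; rewrite ffunE; case: eqP => // jE; rewrite jE ltnn in jm.
have cutV f : f \in V' m.+1 -> cut f \in V' m.
  rewrite !inE => /forallP Vf; apply/forallP => i; have := Vf i; rewrite ltnS.
  have [im'|mi] := ltnP i m.
    by rewrite ltnW // cutlt // (Wpast i (cut f) f) // => j ji; rewrite cutlt // (ltn_trans ji).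
  rewrite ffunE; case: (i =P im) => [->//|nim]; rewrite leq_eqVlt ltnNge mi orbF.
  case: eqP => // iE; case: nim; exact: val_inj.
rewrite (bigD1 im) ?ltnSn //= mulnC.
have -> : \prod_(i < n | (i < m.+1) && (i != im)) w i = \prod_(i < n | i < m) w i.
  by apply: eq_bigl => i; rewrite ltnS [RHS]ltn_neqAle andbC.
rewrite -sum1_card (partition_big cut (mem (V' m))) //=.
apply: (@leq_trans (\sum_(g in V' m) w im)); last by rewrite sum_nat_const leq_mul2r IHm ?orbT // ltnW.
apply: leq_sum => g Vg; have gW (j : 'I_n) : j < m -> g j \in W j g.
  by move=> jm; move: Vg; rewrite inE => /forallP/(_ j); rewrite jm.
apply: leq_trans (Wcard im g gW); rewrite sum1_card.
have fiberE f : f \in V' m.+1 -> cut f = g -> (forall j, j != im -> f j = g j) /\ f im \in W im g.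
  move=> Vf <-; split=> [j /negPf jim|]; first by rewrite ffunE jim.
  rewrite (Wpast im (cut f) f) => [|j]; last exact: cutlt.
  by move: Vf; rewrite inE => /forallP/(_ im); rewrite ltnSn.
rewrite -(card_in_image (f := fun f => f im)) => [|f h]; last first.
  move=> /andP[Vf /eqP fg] /andP[Vh /eqP hg] fhm; apply/ffunP => j.
  have [->//|jm] := eqVneq j im.
  by rewrite (fiberE f Vf fg).1 // (fiberE h Vh hg).1.
apply: subset_leq_card; apply/subsetP => _ /imageP[f /andP[Vf /eqP fg] ->].
exact: (fiberE f Vf fg).2.
Qed.

Variables (S : {set T}) (I : {set 'I_n}) (Z : 'I_n -> {ffun 'I_n -> T} -> {set T}) (P : nat).
Hypotheses (Zpast : forall (i : 'I_n) f g, (forall j : 'I_n, j < i -> f j = g j) -> Z i f = Z i g)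
  (Zcard : forall i f, i \in I -> #|Z i f| <= P) (ZS : forall i f, Z i f \subset S).

Lemma prod_split (c d : 'I_n -> nat) e :
  (forall i, (if i \in I then P else d i) * (if i \in I then e else 1) <=
     (if i \in I then P else 1) * c i) ->
  (\prod_i (if i \in I then P else d i)) * e ^ #|I| <= P ^ #|I| * \prod_i c i.
Proof.
move=> le_cd; rewrite -!prod_nat_const ![\prod_(i in I) _]big_mkcond -!big_split.
exact: leq_prod.
Qed.

Lemma card_rep :
  #|[set f : {ffun 'I_n -> T} | [forall j, f j \in S] & [forall i in I, f i \in Z i f]]| * #|S| ^ #|I|
    <= P ^ #|I| * #|[set f : {ffun 'I_n -> T} | [forall j, f j \in S]]|.
Proof.
have -> : #|[set f : {ffun 'I_n -> T} | [forall j, f j \in S]]| = \prod_(i < n) #|S|.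
  rewrite prod_nat_const card_ord -[n in RHS]card_ord -card_ffun_on.
  by apply: eq_card => f; rewrite !inE.
pose W i f := if i \in I then Z i f else S.
have := @card_sequential W (fun i => if i \in I then P else #|S|).
move=> H; have {}H := H _ _.
apply: leq_trans (@prod_split (fun=> #|S|) (fun=> #|S|) #|S| _); last first.
  by move=> i; case: ifP => _; rewrite ?muln1 ?mul1n.
rewrite leq_mul2r; apply/orP; right; apply: leq_trans (H _ _) => [|i f g fg|i f _].
- apply: subset_leq_card; apply/subsetP => f; rewrite !inE => /andP[/forallP fS /forallP fZ].
  by apply/forallP => i; rewrite /W; have := fZ i; case: (i \in I).
- by rewrite /W (Zpast fg).
- by rewrite /W; case: ifP => // iI; exact: Zcard.
Qed.

(** Values already taken are removed from the choices. A column outside [I] then has [#|S| - i]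
    choices, one in [I] has at most [P], and the factor [#|S| - n] is at most [#|S| - i]. *)
Lemma card_norep :
  #|[set f : {ffun 'I_n -> T} | [forall j, f j \in S] && injectiveb f
       & [forall i in I, f i \in Z i f]]| * (#|S| - n) ^ #|I|
    <= P ^ #|I| * #|[set f : {ffun 'I_n -> T} | [forall j, f j \in S] && injectiveb f]|.
Proof.
have -> : #|[set f : {ffun 'I_n -> T} | [forall j, f j \in S] && injectiveb f]|
    = \prod_(i < n) (#|S| - i).
  rewrite -ffact_prod -[n in RHS]card_ord -card_inj_ffuns_on.
  by apply: eq_card => f; rewrite !inE.
pose W (i : 'I_n) f := (if i \in I then Z i f else S) :\: [set f j | j : 'I_n & j < i].
have H := @card_sequential W (fun i : 'I_n => if i \in I then P else #|S| - i).
apply: leq_trans (@prod_split (fun i => #|S| - i) (fun i => #|S| - i) (#|S| - n) _); last first.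
  move=> i; case: ifP => _; rewrite ?muln1 ?mul1n // leq_mul2l leq_sub2l ?orbT //.
  exact: ltnW.
rewrite leq_mul2r; apply/orP; right; apply: leq_trans (H _ _) => [|i f g fg|i f fW].
- apply: subset_leq_card; apply/subsetP => f; rewrite !inE.
  move=> /andP[/andP[/forallP fS /injectiveP finj] /forallP fZ].
  apply/forallP => i; rewrite in_setD; apply/andP; split.
    apply/imsetP => -[j]; rewrite inE => ji /finj ij; by rewrite ij ltnn in ji.
  by have := fZ i; case: (i \in I).
- rewrite /W (Zpast fg); congr (_ :\: _); apply/setP => z.
  by apply/imsetP/imsetP => -[j]; rewrite inE => ji ->; exists j; rewrite ?inE ?fg.
have fS (j : 'I_n) : j < i -> f j \in S.
  move=> ji; have := fW j ji; rewrite /W inE => /andP[_].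
  by case: ifP => // _; exact: (subsetP (ZS j f)).
have finj (j j' : 'I_n) : j < i -> j' < j -> f j != f j'.
  move=> ji j'j; have := fW j ji; rewrite /W inE => /andP[nf _].
  by apply: contraNneq nf => ->; apply/imsetP; exists j'; rewrite ?inE.
rewrite /W; case: ifP => iI.
  by apply: leq_trans (Zcard f iI); rewrite subset_leq_card // subsetDl.
rewrite cardsD (setIidPr _); last first.
  by apply/subsetP => z /imsetP[j]; rewrite inE => ji ->; exact: fS.
rewrite card_in_imset => [|j j']; last first.
  rewrite !inE => ji j'i /eqP ff; apply: val_inj => /=.
  case: (ltngtP j j') => // jj'; [have := finj _ _ j'i jj' | have := finj _ _ ji jj'].
    by rewrite eq_sym ff.
  by rewrite ff.
apply: leq_sub2l; have widen_inj : injective (widen_ord (ltnW (ltn_ord i))).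
  by move=> j j' /(congr1 val) /= /val_inj.
apply: (@leq_trans #|image (widen_ord (ltnW (ltn_ord i))) predT|).
  by rewrite card_image // card_ord.
by apply: subset_leq_card; apply/subsetP => _ /imageP[j _ ->]; rewrite !inE; exact: (ltn_ord j).
Qed.

End Counting.

(** * Failure for a fixed hypergraph, for either way of drawing the columns *)

Section HypergraphFailure.
Variables (F : finFieldType) (K : closedFieldType) (iota : {rmorphism F -> K}).
Variables (k kap L n c m : nat) (X : 'cV[K]_k -> Prop) (S : {set 'cV[F]_k}).
Variables (B : 'M[K]_(kap, k)) (E : 'I_n -> {set 'I_L.+1}) (J : {set 'I_L.+1}).
Variable Omega : {set {ffun 'I_n -> 'cV[F]_k}}.

Hypotheses (Xprime : prime_locus X) (Xmds : MDS_variety X) (Bfree : row_free B).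
Hypothesis SX : forall z, z \in S -> X (map_mx iota z).
Hypothesis OmegaS : forall f, f \in Omega -> forall j, f j \in S.
Hypothesis Omega_count : forall (I : {set 'I_n})
    (Z : 'I_n -> {ffun 'I_n -> 'cV[F]_k} -> {set 'cV[F]_k}) P,
  (forall (i : 'I_n) (f g : {ffun 'I_n -> 'cV[F]_k}),
    (forall j : 'I_n, (j < i)%N -> f j = g j) -> Z i f = Z i g) ->
  (forall i f, i \in I -> #|Z i f| <= P)%N -> (forall i f, Z i f \subset S) ->
  (#|[set f in Omega | [forall i in I, f i \in Z i f]]| * m ^ #|I| <= P ^ #|I| * #|Omega|)%N.
Hypothesis c_gt0 : (0 < c)%N.
Hypothesis Econn :
  partition_connected (kap + (c.-1 + c)) [seq E j | j <- enum 'I_n] J.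

Let pts (f : {ffun 'I_n -> 'cV[F]_k}) (j : 'I_n) := map_mx iota (f j).

(** With the earlier columns fixed, the polynomial of [generically_rigid_open] does not vanish
    identically on [X] and is zero at each faulty value; its degree is at most [L] because there are
    [L.+1] vertices. *)
Lemma card_fault_locus b x A R i :
  (#|[set z in S | asb (fault_at X B E J b x A R i (map_mx iota z))]| <= Pq iota X L)%N.
Proof.
set Z := [set _ in _ | _]; have [->|[z0]] := set_0Vmem Z; first by rewrite cards0.
rewrite inE => /andP[_ /asbP]; rewrite /fault_at; case st: (run _ _ _ _ _ _) => [s l].
move=> [iA il rig _]; have [p [sp p0 prig]] := generically_rigid_open (ltn0Sn L) il rig.
apply: (@leq_trans #|rat_zeros iota X p|).
  apply/subset_leq_card/subsetP => z; rewrite !inE => /andP[zS /asbP].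
  rewrite /fault_at st => -[_ _ _ nrig]; apply/asbP; split; first exact: SX.
  by apply/eqP/negPn/negP => /prig.
by apply: leq_bigmax_cond; apply/asbP; exists p.
Qed.

Lemma card_hypergraph_failure :
  (#|[set f in Omega | asb (~ rigid B J lev0 [seq (E j, pts f j) | j <- enum 'I_n])]| * m ^ c
   <= 'C(n, c) * (2 ^ L.+1) ^ c * (Pq iota X L ^ c * #|Omega|))%N.
Proof.
set u := (2 ^ L.+1)%N; have u0 : (0 < u)%N by rewrite expn_gt0.
(* The quotient by the number of passes: the reserve takes at most [u * b <= c] columns, while [u]
   passes with more than [b] faults each reach [c]. *)
pose b := (c %/ u)%N; pose d0 := Ordinal u0.
(* Labels are fixed to [d0] outside the chosen set, so each set of [c] columns carries exactly
   [u ^ c] labellings. *)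
pose cert_type (Ig : {set 'I_n} * {ffun 'I_n -> 'I_u}) :=
  (#|Ig.1| == c) && (Ig.2 \in pffun_on d0 (mem Ig.1) predT).
pose Z (Ig : {set 'I_n} * {ffun 'I_n -> 'I_u}) (i : 'I_n) (f : {ffun 'I_n -> 'cV[F]_k}) :=
  [set z in S | asb (fault_at X B E J b (pts f) [set j in Ig.1 | (Ig.2 j < Ig.2 i)%N]
                       [set j in Ig.1 | Ig.2 j == Ig.2 i :> nat] i (map_mx iota z))].
pose D (Ig : {set 'I_n} * {ffun 'I_n -> 'I_u}) := [set f in Omega | [forall i in Ig.1, f i \in Z Ig i f]].
have cover f : f \in [set f in Omega | asb (~ rigid B J lev0 [seq (E j, pts f j) | j <- enum 'I_n])] ->
    exists2 Ig, cert_type Ig & f \in D Ig.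
  rewrite inE => /andP[Of /asbP nrig].
  (* The surplus in [Econn] splits into [c.-1] for the discarded columns and [c] for the reserve. *)
  have rig0 (A : {set 'I_n}) : (#|A| < c)%N -> generically_rigid X B J [::] (reserve E b A).
    move=> Ac; apply: reserve_rigid Econn _ => //; apply: leq_add.
      by rewrite -ltnS prednK.
    by rewrite mulnC leq_trunc_div.
  have [I [lab [leI geI labu cert]]] := certificate_exists u (ltn0Sn L) rig0 nrig.
  have cI : #|I| = c.
    apply/eqP; rewrite eqn_leq leI; apply: leq_trans geI; rewrite leq_min leqnn /=.
    by rewrite mulnC ltnW // ltn_ceil.
  pose g := [ffun i => if i \in I then insubd d0 (lab i) else d0].
  have gE i : i \in I -> g i = lab i :> nat.
    by move=> Ii; rewrite ffunE Ii /insubd insubT // labu.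
  exists (I, g).
    rewrite /cert_type cI eqxx; apply/pffun_onP; split=> //.
    by apply/subsetP => i; rewrite inE ffunE; case: ifP => //; rewrite eqxx.
  rewrite inE Of; apply/forall_inP => i Ii; rewrite inE OmegaS //; apply/asbP.
  have := cert i Ii; congr fault_at; apply/setP => j; rewrite !inE /=.
    by case: (boolP (j \in I)) => //= Ij; rewrite !gE.
  by case: (boolP (j \in I)) => //= Ij; rewrite !gE.
have cardD Ig : cert_type Ig -> (#|D Ig| * m ^ c <= Pq iota X L ^ c * #|Omega|)%N.
  move=> /andP[/eqP <- _]; apply: Omega_count => [i f g fg|i f _|i f].
  - apply/setP => z; rewrite !inE; congr (_ && _); apply/asbP/asbP; apply: eq_fault_at => // j ji.
      by rewrite /pts fg.
    by rewrite /pts fg.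
  - exact: card_fault_locus.
  - by apply/subsetP => z; rewrite inE => /andP[].
apply: leq_trans (leq_mul (union_bound cover) (leqnn _)) _.
rewrite big_distrl /=.
apply: (@leq_trans (\sum_(Ig | cert_type Ig) (Pq iota X L ^ c * #|Omega|))%N).
  exact: leq_sum.
rewrite sum_nat_const leq_mul2r; apply/orP; right.
rewrite -sum1_card -(pair_big_dep (fun I : {set 'I_n} => #|I| == c)
  (fun I g => g \in pffun_on d0 (mem I) predT) (fun _ _ => 1%N)) /=.
rewrite (eq_bigr (fun=> (u ^ c)%N)) => [|I /eqP <-]; last first.
  by rewrite sum1_card card_pffun_on card_ord.
by rewrite sum_nat_const -(card_ord n) -card_draws (card_ord n) leq_mul2r; apply/orP; right; apply/subset_leq_card/subsetP => I; rewrite !inE.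
Qed.

End HypergraphFailure.

(** * Failure of list decoding *)

Lemma irreducible_prime (K : fieldType) k (X : 'cV[K]_k -> Prop) (f g : {mpoly K[k]}) :
  irreducible_variety X ->
  (exists x, X x /\ ev f x != 0) -> (exists x, X x /\ ev g x != 0) ->
  exists x, [/\ X x, ev f x != 0 & ev g x != 0].
Proof.
move=> [_ _ irr] [x1 [X1 f1]] [x2 [X2 g2]]; apply: NNPP => no.
have closed1 (p : {mpoly K[k]}) : zariski_closed (fun x => ev p x = 0).
  by exists (eq p) => x; split=> [p0 _ <- //|]; apply.
case: (irr _ _ (closed1 f) (closed1 g)) => [x Xx|f0|g0].
- apply: NNPP => nfg; apply: no; exists x.
  by split=> //; apply/eqP => e0; apply: nfg; [left | right].
- by rewrite f0 ?eqxx in f1.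
- by rewrite g0 ?eqxx in g2.
Qed.

Lemma avg_radius_failure (l n rk r w : nat) : (0 < n)%N ->
  ~ (w%:R / l.+1%:R > (l%:R / l.+1%:R) * ((n%:R - rk%:R - r%:R) / n%:R) * n%:R :> rat) ->
  (w + l * (rk + r) <= l * n)%N.
Proof.
move=> n0 /negP; rewrite -leNgt => H.
have n0' : n%:R != 0 :> rat by rewrite pnatr_eq0 -lt0n.
have l0' : (0 : rat) < l.+1%:R by rewrite ltr0n.
move: H; rewrite mulrA divfK // mulrAC ler_pM2r ?invr_gt0 // => H.
rewrite -(ler_nat rat) natrD !natrM natrD; lra.
Qed.

Section PartitionConnectedness.
Local Open Scope nat_scope.
Variable T : finType.
Implicit Types (J A : {set T}) (fam : seq {set T}).

Lemma partition_connected_leq q q' fam J : q' <= q ->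
  partition_connected q fam J -> partition_connected q' fam J.
Proof. by move=> le_q pc f; apply: leq_trans (pc f); rewrite leq_mul2r le_q orbT. Qed.

Lemma partition_connected_restrict q fam J :
  partition_connected q fam J -> partition_connected q [seq A :&: J | A <- fam] J.
Proof.
move=> pc f; apply: (leq_trans (pc f)); rewrite big_map.
by apply: leq_sum => A _; rewrite -setIA setIid.
Qed.

(** Otherwise the partition of [J] into [v] and the rest would be crossed by no edge. *)
Lemma partition_connected_cover q fam J v : 0 < q -> 1 < #|J| ->
  partition_connected q fam J -> v \in J -> exists2 A, A \in fam & v \in A.
Proof.
move=> q0 J2 pc Jv; apply: NNPP => no.
have /set0Pn[w /setD1P[wv Jw]] : J :\ v != set0.
  by rewrite -card_gt0; move: J2; rewrite (cardsD1 v) Jv.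
have := pc (fun u => if u == v then v else w).
rewrite big1_seq => [|A /andP[_ Af]].
  rewrite leqn0 muln_eq0 -leqn0 leqNgt q0 /= => /eqP E.
  have : #|[set v; w]| <= #|(fun u => if u == v then v else w) @: J|.
    apply/subset_leq_card/subsetP => u /set2P[->|->]; apply/imsetP.
      by exists v => //; rewrite eqxx.
    by exists w => //; rewrite (negPf wv).
  by rewrite cards2 eq_sym wv; move: E; case: #|_| => [|[]].
have : #|(fun u => if u == v then v else w) @: (A :&: J)| <= #|[set w]|.
  apply/subset_leq_card/subsetP => _ /imsetP[u /setIP[Au _] ->]; rewrite inE.
  by case: (u =P v) => // uv; case: no; exists A => //; rewrite -uv.
by rewrite cards1; case: #|_| => [|[]].
Qed.

(** A smallest dense subset with at least two vertices has only sparse proper subsets. *)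
Lemma dense_partition_connected q fam J0 : 1 < #|J0| -> q * #|J0|.-1 <= weight fam J0 ->
  exists J, [/\ J \subset J0, 1 < #|J| & partition_connected q fam J].
Proof.
move=> J2 wJ; pose P J := [&& J \subset J0, 1 < #|J| & q * #|J|.-1 <= weight fam J].
have P0 : P J0 by rewrite /P subxx J2.
case: (arg_minnP (fun J : {set T} => #|J|) P0) => J /and3P[sJ cJ wJ'] minJ.
exists J; split=> //; apply: partition_connected_of_weight => // S pS S2.
rewrite leqNgt; apply/negP => /ltnW wS; have /minJ : P S.
  by rewrite /P S2 wS (subset_trans (proper_sub pS)).
by rewrite leqNgt proper_card.
Qed.

End PartitionConnectedness.

(** * From a failing matrix to a hypergraph that is not rigid *)

Section Reduction.
Variables (F : finFieldType) (K : closedFieldType) (iota : {rmorphism F -> K}).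
Variables (k n r L : nat).
Hypotheses (r0 : (0 < r)%N) (L0 : (0 < L)%N) (le_rn : (r <= n)%N).

(* If [G] has rank less than [kap], the hypergraph all of whose edges are full
   already accounts for the failure; otherwise a failing [G] has rank [k]. *)
Let kap := minn k (n - r).+1.
Let B : 'M[K]_(kap, k) := pid_mx kap.

Let pts (f : {ffun 'I_n -> 'cV[F]_k}) (j : 'I_n) := map_mx iota (f j).

Lemma mulmx_pts m (U : 'M[F]_(m, k)) f j v :
  (map_mx iota U *m pts f j) v ord0 = iota ((U *m mx_of_cols f) v j).
Proof.
rewrite !mxE rmorph_sum; apply: eq_bigr => i _.
by rewrite !mxE rmorphM.
Qed.

(** A nonzero combination [u] of the first [kap] rows vanishes on every column. As the message at
    one vertex, with 0 at the others, it satisfies all conditions; [L > 0] supplies a second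
    vertex. *)
Lemma rank_failure f : (\rank (mx_of_cols f) < kap)%N ->
  ~ rigid B [set: 'I_L.+1] lev0 [seq (setT, pts f j) | j <- enum 'I_n].
Proof.
move=> rk rig; pose Bf : 'M[F]_(kap, k) := pid_mx kap.
have /rowV0Pn[u /sub_kermxP uG u0] : kermx (Bf *m mx_of_cols f) != 0.
  rewrite kermx_eq0 -row_leq_rank -ltnNge.
  exact: leq_ltn_trans (mxrankM_maxr _ _) rk.
pose m : 'M[K]_(L.+1, kap) := \matrix_(v, a) (if v == ord0 then iota (u ord0 a) else 0).
have mE : m = (\col_v (v == ord0)%:R) *m map_mx iota u.
  by apply/matrixP => v a; rewrite !mxE big_ord1 !mxE; case: eqP; rewrite ?mul1r ?mul0r.
have mB : m *m B = (\col_v (v == ord0)%:R) *m map_mx iota (u *m Bf).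
  by rewrite mE map_mxM map_pid_mx mulmxA.
have comp : compatible B setT lev0 [seq (setT, pts f j) | j <- enum 'I_n] m.
  split=> // ez /mapP[j _ ->] v w _ _ /=; rewrite !mulmxA mB -!mulmxA.
  suff -> : map_mx iota (u *m Bf) *m pts f j = 0 by rewrite mulmx0 !mxE.
  by apply/matrixP => i i'; rewrite !ord1 mulmx_pts -mulmxA uG !mxE rmorph0.
have max0 : (ord_max == ord0 :> 'I_L.+1) = false by rewrite -val_eqE /= eqn0Ngt L0.
case/eqP: u0; apply/rowP => a; apply: (fmorph_inj iota).
have /rowP/(_ a) := rig m comp ord0 ord_max (in_setT _) (in_setT _).
by rewrite !mxE eqxx max0 rmorph0.
Qed.

(** Each of the [n] full edges crosses a partition into p parts p - 1 times, and the cap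
    [(n - r).+1] on [kap] keeps the required connectivity at most [n]. *)
Lemma full_connected fam : fam = [seq [set: 'I_L.+1] | j <- enum 'I_n] ->
  partition_connected (kap + (r./2.-1 + r./2)) fam setT.
Proof.
move=> -> g; rewrite big_map big_enum /= sum_nat_const card_ord setIT leq_mul2r.
apply/orP; right; apply: (@leq_trans ((n - r).+1 + (r./2.-1 + r./2))).
  by rewrite leq_add2r geq_minr.
have := odd_double_half r; rewrite -addnn; have := r0; have := le_rn.
by move: (odd r) (r./2) => [] h; lia.
Qed.

Section CloseCodewords.
Variables (f : {ffun 'I_n -> 'cV[F]_k}) (l : nat) (y : 'rV[F]_n) (c : 'I_l.+1 -> 'rV[F]_n).
Hypotheses (c_inj : injective c) (cG : forall i, (c i <= mx_of_cols f)%MS).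
Hypotheses (l0 : (0 < l)%N) (lL : (l <= L)%N).
Hypothesis close : (\sum_(i < l.+1) wt (y - c i) + l * (k + r) <= l * n)%N.

Let agree j := [set v : 'I_L.+1 | (v < l.+1)%N && (c (inord v) ord0 j == y ord0 j)].
Let J0 := [set v : 'I_L.+1 | (v < l.+1)%N].

Let wid (i : 'I_l.+1) : 'I_L.+1 := widen_ord (lL : (l.+1 <= L.+1)%N) i.

Lemma wid_inj : injective wid.
Proof. by move=> i j /(congr1 val) /= /val_inj. Qed.

Lemma agree_wid j : agree j = wid @: [set i | c i ord0 j == y ord0 j].
Proof.
apply/setP => v; rewrite inE; apply/andP/imsetP => [[vl cv]|[i]].
  by exists (inord v); rewrite ?inE //; apply: val_inj; rewrite /= inordK.
by rewrite inE => ci ->; rewrite /= ltn_ord inord_val.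
Qed.

Lemma J0_wid : J0 = wid @: setT.
Proof.
apply/setP => v; rewrite inE; apply/idP/imsetP => [vl|[i _ ->]]; last exact: (ltn_ord i).
by exists (inord v) => //; apply: val_inj; rewrite /= inordK.
Qed.

Lemma sum_agree : (\sum_j #|agree j| + \sum_(i < l.+1) wt (y - c i) = l.+1 * n)%N.
Proof.
have -> : (\sum_j #|agree j| = \sum_(i < l.+1) #|[set j | c i ord0 j == y ord0 j]|)%N.
  transitivity (\sum_j \sum_(i < l.+1) (c i ord0 j == y ord0 j))%N.
    apply: eq_bigr => j _; rewrite agree_wid card_imset; last exact: wid_inj.
    by rewrite -sum1_card big_mkcond; apply: eq_bigr => i _; rewrite inE; case: eqP.
  rewrite exchange_big; apply: eq_bigr => i _.
  by rewrite -sum1_card [RHS]big_mkcond; apply: eq_bigr => j _; rewrite inE; case: eqP.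
rewrite -big_split /= (eq_bigr (fun=> n)) ?sum_nat_const ?card_ord // => i _.
rewrite /wt -[in RHS](card_ord n) -(cardsC [set j | c i ord0 j == y ord0 j]).
congr (_ + #|pred_of_set _|)%N; apply/setP => j.
by rewrite !inE !mxE subr_eq0 eq_sym.
Qed.

(** In total the codewords agree with [y] at least [n + l * (k + r)] times, and passing to the
    weight loses at most one per column. *)
Lemma close_dense : (1 < #|J0| /\
  (k + r) * #|J0|.-1 <= weight [seq agree j | j <- enum 'I_n] J0)%N.
Proof.
have cJ : #|J0| = l.+1.
  by rewrite J0_wid card_imset; [rewrite cardsT card_ord | exact: wid_inj].
rewrite cJ; split=> //=; rewrite /weight big_map big_enum /=.
have agreeJ j : agree j :&: J0 = agree j.
  by apply/setIidPl/subsetP => v; rewrite !inE => /andP[].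
have : (\sum_j #|agree j| <= \sum_j #|agree j :&: J0|.-1 + n)%N.
  have nE : (\sum_(j < n) 1 = n)%N by rewrite sum1_card card_ord.
  rewrite -[X in (_ + X)%N]nE -big_split; apply: leq_sum => j _ /=.
  by rewrite agreeJ; case: #|_| => // a; rewrite addn1.
have := sum_agree; move: close; rewrite mulSn mulnC.
move: (\sum_j _)%N (\sum_j _)%N (\sum_(_ < _) _)%N ((k + r) * l)%N (l * n)%N => *; lia.
Qed.

Lemma close_not_rigid : kap = k -> exists E : {ffun 'I_n -> {set 'I_L.+1}},
  partition_connected (k + r) [seq E j | j <- enum 'I_n] (\bigcup_j E j) /\
  ~ rigid B (\bigcup_j E j) lev0 [seq (E j, pts f j) | j <- enum 'I_n].
Proof.
move=> kapk; have [J0_2 wJ0] := close_dense.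
have [J [sJ J2 pcJ]] := dense_partition_connected J0_2 wJ0.
(* Cutting the edges down to [J] makes [J] their union, so that [E] alone records the hypergraph in
   the union bound. *)
pose E := [ffun j => agree j :&: J] : {ffun 'I_n -> {set 'I_L.+1}}.
have JE : \bigcup_j E j = J.
  apply/setP => v; apply/bigcupP/idP => [[j _]|Jv]; first by rewrite ffunE inE => /andP[].
  have [|_ /mapP[j _ ->] vj] := partition_connected_cover _ J2 pcJ Jv.
    by rewrite addn_gt0 r0 orbT.
  by exists j; rewrite // ffunE inE vj.
exists E; rewrite JE; split.
  have := partition_connected_restrict pcJ; rewrite -map_comp.
  by congr partition_connected; apply: eq_map => j /=; rewrite ffunE.
have /fin_all_exists[u uE] (i : 'I_l.+1) : exists u : 'rV_k, c i = u *m mx_of_cols f.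
  exact/submxP/cG.
pose U : 'M[K]_(L.+1, k) := \matrix_v map_mx iota (u (inord v)).
pose m : 'M[K]_(L.+1, kap) := U *m pid_mx kap.
have mB : m *m B = U.
  rewrite -mulmxA pid_mx_id ?geq_minl // -[RHS]mulmx1; congr (_ *m _).
  by rewrite -pid_mx_1; congr pid_mx.
have Upts j v : (U *m pts f j) v ord0 = iota (c (inord v) ord0 j).
  rewrite uE -mulmx_pts !mxE; apply: eq_bigr => i _; by rewrite !mxE.
(* Codewords that agree with [y] at a column agree there with each other. *)
move=> rig; have comp : compatible B J lev0 [seq (E j, pts f j) | j <- enum 'I_n] m.
  split=> // ez /mapP[j _ ->] v w /=; rewrite mulmxA mB !Upts ffunE !inE.
  by move=> /andP[/andP[/andP[_ /eqP->] _] _] /andP[/andP[/andP[_ /eqP->] _] _].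
have /card_gt1P[v [w [Jv Jw /eqP vw]]] := J2; apply: vw.
have := congr1 (mulmxr B) (rig m comp v w Jv Jw); rewrite /= -!row_mul mB !rowK.
move=> /map_mx_inj uvw; have /c_inj vw : c (inord v) = c (inord w) by rewrite !uE uvw.
have := subsetP sJ v Jv; have := subsetP sJ w Jw; rewrite !inE => lw lv.
by apply: val_inj; rewrite /= -(inordK lv) -(inordK lw) vw.
Qed.

End CloseCodewords.

Lemma failure_hypergraph f : (0 < n)%N -> ~ rLD_MDS_le r L (mx_of_cols f) ->
  exists E : {ffun 'I_n -> {set 'I_L.+1}},
    partition_connected (kap + (r./2.-1 + r./2)) [seq E j | j <- enum 'I_n] (\bigcup_j E j) /\
    ~ rigid B (\bigcup_j E j) lev0 [seq (E j, pts f j) | j <- enum 'I_n].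
Proof.
move=> n0 fail; set G := mx_of_cols f in fail.
have [rk|rk] := ltnP (\rank G) kap.
  pose E := [ffun=> setT] : {ffun 'I_n -> {set 'I_L.+1}}; exists E.
  have -> : \bigcup_j E j = setT.
    apply/setP => v; rewrite inE; apply/bigcupP; exists (Ordinal n0) => //.
    by rewrite ffunE inE.
  split; first by apply: full_connected; apply: eq_map => j; rewrite ffunE.
  under eq_map => j do rewrite ffunE; exact: rank_failure.
have [l [/andP[l0 lL] nl]] : exists l, (1 <= l <= L)%N /\ ~ rLD_MDS r l G.
  by apply: NNPP => no; apply: fail => l ll; apply: NNPP => nl; apply: no; exists l.
have [y [c [c_inj [cG nclose]]]] : exists y (c : 'I_l.+1 -> 'rV[F]_n), injective c /\
    (forall i, c i <= G)%MS /\
    ~ ((\sum_(i < l.+1) wt (y - c i))%:R / (l.+1)%:R >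
       (l%:R / l.+1%:R) * ((n%:R - (\rank G)%:R - r%:R) / n%:R) * n%:R :> rat).
  apply: NNPP => no; apply: nl => y c c_inj cG; apply: NNPP => nle; apply: no.
  by exists y, c.
have close := avg_radius_failure n0 nclose.
(* Such a list exists only if [\rank G + r <= n]. As the rank is at least [kap], the minimum in
   [kap] is then [k], since a rank of [(n - r).+1] would be too large. *)
have rkn : (\rank G + r <= n)%N.
  by rewrite -(leq_pmul2l l0); apply: leq_trans close; exact: leq_addl.
have kapk : kap = k.
  apply/minn_idPl; rewrite leqNgt; apply/negP => /ltnW lt_k.
  move: rk; rewrite /kap (minn_idPr lt_k) => rk; lia.
have rkk : \rank G = k by apply/eqP; rewrite eqn_leq rank_leq_row -[X in (X <= _)%N]kapk.
rewrite rkk in close; have [E [pcE nrig]] := close_not_rigid c_inj cG l0 lL close kapk.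
exists E; split=> //; apply: partition_connected_leq pcE.
rewrite kapk leq_add2l; have := odd_double_half r; rewrite -addnn.
by move: (odd r) (r./2) => [] h; lia.
Qed.

End Reduction.

(** * Union bound over the hypergraphs *)

Section Bound.
Variables (F : finFieldType) (K : closedFieldType) (iota : {rmorphism F -> K}).
Variables (k n r L m : nat) (X : 'cV[K]_k -> Prop) (S : {set 'cV[F]_k}).
Variable Omega : {set {ffun 'I_n -> 'cV[F]_k}}.
Hypotheses (Xirr : irreducible_variety X) (Xmds : MDS_variety X).
Hypothesis SX : forall z, z \in S -> X (map_mx iota z).
Hypotheses (r0 : (0 < r)%N) (r_even : ~~ odd r) (L0 : (0 < L)%N) (m0 : (0 < m)%N).
Hypothesis OmegaS : forall f, f \in Omega -> forall j, f j \in S.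
Hypothesis Omega_count : forall (I : {set 'I_n})
    (Z : 'I_n -> {ffun 'I_n -> 'cV[F]_k} -> {set 'cV[F]_k}) P,
  (forall (i : 'I_n) (f g : {ffun 'I_n -> 'cV[F]_k}),
    (forall j : 'I_n, (j < i)%N -> f j = g j) -> Z i f = Z i g) ->
  (forall i f, i \in I -> #|Z i f| <= P)%N -> (forall i f, Z i f \subset S) ->
  (#|[set f in Omega | [forall i in I, f i \in Z i f]]| * m ^ #|I| <= P ^ #|I| * #|Omega|)%N.

Let bad := [set f in Omega | asb (~ rLD_MDS_le r L (mx_of_cols f))].

Lemma card_bad :
  (#|bad| * m ^ r./2 <= 2 ^ (L.+1 * n) * 'C(n, r./2) * 2 ^ (r * L.+1)./2 *
     (Pq iota X L ^ r./2 * #|Omega|))%N.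
Proof.
have Xprime : prime_locus X.
  by have [_ X0 _] := Xirr; split=> // f g; exact: irreducible_prime.
have rE : r = (r./2 * 2)%N by rewrite muln2 even_halfK.
have c0 : (0 < r./2)%N by rewrite half_gt0; move: r0 r_even; case: r => [|[]].
(* No matrix is bad in these cases: for [n = 0] there is only one codeword, and for [n < r] a
   failure would need a negative sum of weights. *)
have bad0 : (n < r)%N || (n == 0)%N -> bad = set0.
  move=> small; apply/setP => f; rewrite !inE; apply/negP => /andP[_ /asbP]; apply.
  move=> l /andP[l0 _] y c c_inj cG; rewrite ltNge; apply/negP => fail.
  have [n0|n0] := posnP n.
    have /c_inj /(congr1 val) /= : c ord0 = c ord_max.
      by apply/rowP => j; case: (leq_trans (ltn_ord j) (eq_leq n0)).
    by move=> E; rewrite -E in l0.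
  have := @avg_radius_failure l n (\rank (mx_of_cols f)) r _ n0 _.
  move=> /(_ (\sum_(i < l.+1) wt (y - c i))%N) H; have {}H := H _.
  have nr : (n < r)%N by case/orP: small => // /eqP n0'; rewrite n0' in n0.
  have : (l * (\rank (mx_of_cols f) + r) <= l * n)%N.
    apply: leq_trans (H _); first exact: leq_addl.
    by apply/negP; rewrite -leNgt.
  by rewrite leq_pmul2l // leqNgt (leq_trans nr) // leq_addl.
have [/bad0->|] := boolP ((n < r)%N || (n == 0)%N); first by rewrite cards0 mul0n.
rewrite negb_or -leqNgt -lt0n => /andP[rn n0].
set kap := minn k (n - r).+1; pose B : 'M[K]_(kap, k) := pid_mx kap.
have Bfree : row_free B by rewrite /row_free rank_pid_mx ?geq_minl.
pose pcE (E : {ffun 'I_n -> {set 'I_L.+1}}) := asb (partition_connected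
  (kap + (r./2.-1 + r./2)) [seq E j | j <- enum 'I_n] (\bigcup_j E j)).
pose D (E : {ffun 'I_n -> {set 'I_L.+1}}) := [set f in Omega | asb (~ rigid B (\bigcup_j E j) lev0
  [seq (E j, map_mx iota (f j)) | j <- enum 'I_n])].
have cover f : f \in bad -> exists2 E, pcE E & f \in D E.
  rewrite inE => /andP[Of /asbP fail].
  have [E [pc nrig]] := failure_hypergraph iota r0 L0 rn n0 fail.
  by exists E; [exact/asbP | rewrite inE Of; exact/asbP].
have cardD E : pcE E -> (#|D E| * m ^ r./2 <=
    'C(n, r./2) * (2 ^ L.+1) ^ r./2 * (Pq iota X L ^ r./2 * #|Omega|))%N.
  move=> /asbP pc; exact: (card_hypergraph_failure Xprime Xmds Bfree SX OmegaS Omega_count c0 pc).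
apply: leq_trans (leq_mul (union_bound cover) (leqnn _)) _.
rewrite big_distrl /=.
apply: (@leq_trans (\sum_(E | pcE E)
    ('C(n, r./2) * (2 ^ L.+1) ^ r./2 * (Pq iota X L ^ r./2 * #|Omega|)))%N).
  exact: leq_sum.
rewrite sum_nat_const -!mulnA leq_mul //.
  apply: leq_trans (max_card _) _.
  by rewrite card_ffun card_ord card_sets_ord -expnM.
(* Evenness of [r] turns [(2 ^ L.+1) ^ r./2] into [2 ^ (r * L.+1)./2]. *)
by rewrite -expnM (_ : r * L.+1 = (L.+1 * r./2).*2)%N ?doubleK // [in LHS]rE -muln2 mulnC mulnA.
Qed.

Lemma good_fraction : (0 < #|Omega|)%N ->
  1 - fail_bound n r L (Pq iota X L) m <=
  #|[set f in Omega | asb (rLD_MDS_le r L (mx_of_cols f))]|%:R / #|Omega|%:R.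
Proof.
move=> O0; have := card_bad; set good := [set f in Omega | _].
have OE : (#|good| + #|bad| = #|Omega|)%N.
  rewrite -(cardsID good Omega); congr (_ + _)%N; apply: eq_card => f; rewrite !inE.
    by case: (f \in Omega).
  case: (f \in Omega); rewrite ?andbF ?andbT //=.
  by apply/asbP/negP => nf; [move/asbP | move=> g; apply: nf; apply/asbP].
set C := (2 ^ (L.+1 * n) * 'C(n, r./2) * 2 ^ (r * L.+1)./2)%N.
rewrite /fail_bound -/C; set P := Pq iota X L => le_bad.
have O0' : (0 : rat) < #|Omega|%:R by rewrite ltr0n.
have m0' : (0 : rat) < m%:R ^+ r./2 by rewrite exprn_gt0 // ltr0n.
rewrite ler_pdivlMr // mulrBl mul1r lerBlDr.
rewrite [leLHS](_ : _ = #|good|%:R + #|bad|%:R) ?lerD2l; last by rewrite -natrD OE.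
rewrite expr_div_n mulrA mulrAC ler_pdivlMr //.
by rewrite -!natrX -!natrM ler_nat -mulnA.
Qed.

End Bound.

Theorem theorem4p10 (F : finFieldType) (K : closedFieldType)
    (iota : {rmorphism F -> K})
    (K_alg : forall z : K, exists p : {poly F}, p != 0 /\ root (map_poly iota p) z)
    (k n r L : nat) (X : 'cV[K]_k -> Prop) (S : {set 'cV[F]_k}) :
  irreducible_variety X -> MDS_variety X ->
  (forall x, x \in S -> X (map_mx iota x)) ->
  (0 < r)%N -> ~~ odd r -> (0 < L)%N -> (0 < #|S|)%N ->
  1 - fail_bound n r L (Pq iota X L) #|S|
    <= prob_rep S (@rLD_MDS_le F k n r L)
  /\ ((n < #|S|)%N ->
      1 - fail_bound n r L (Pq iota X L) (#|S| - n)
        <= prob_norep S (@rLD_MDS_le F k n r L)).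
Proof.
move=> Xirr Xmds SX r0 r_even L0 S0; split=> [|ltnS].
  have := @good_fraction F K iota k n r L #|S| X S
    [set f : {ffun 'I_n -> 'cV[F]_k} | [forall j, f j \in S]] Xirr Xmds SX r0 r_even L0 S0.
  rewrite /prob_rep (_ : [set f in _ | _] = [set f : {ffun 'I_n -> 'cV[F]_k} |
     [forall j, f j \in S] && asb (rLD_MDS_le r L (mx_of_cols f))]); last first.
    by apply/setP => f; rewrite !inE.
  apply=> [f|I Z P Zpast Zcard ZS|].
  - by rewrite inE => /forallP.
  - have := card_rep S Zpast Zcard; congr (_ * _ <= _)%N.
    by apply: eq_card => f; rewrite !inE.
  - have [z zS] := card_gt0P S0; apply/card_gt0P; exists [ffun=> z].
    by rewrite inE; apply/forallP => j; rewrite ffunE.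
have := @good_fraction F K iota k n r L (#|S| - n) X S
  [set f : {ffun 'I_n -> 'cV[F]_k} | [forall j, f j \in S] && injectiveb f]
  Xirr Xmds SX r0 r_even L0.
rewrite subn_gt0 => /(_ ltnS).
rewrite /prob_norep (_ : [set f in _ | _] = [set f : {ffun 'I_n -> 'cV[F]_k} |
   [&& [forall j, f j \in S], injectiveb f & asb (rLD_MDS_le r L (mx_of_cols f))]]); last first.
  by apply/setP => f; rewrite !inE andbA.
apply=> [f|I Z P Zpast Zcard ZS|].
- by rewrite inE => /andP[/forallP].
- have := card_norep Zpast Zcard ZS; congr (_ * _ <= _)%N.
  by apply: eq_card => f; rewrite !inE.
- have -> : #|[set f : {ffun 'I_n -> 'cV[F]_k} | [forall j, f j \in S] && injectiveb f]|
      = (#|S| ^_ #|'I_n|)%N.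
    by rewrite -card_inj_ffuns_on; apply: eq_card => f; rewrite !inE.
  by rewrite ffact_gt0 card_ord ltnW.
Qed.
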